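(* Let $(A,G,\alpha)$ be a pre-ordered Banach algebra dynamical system, with $A$ having a closed cone and a (not necessarily positive) bounded approximate right identity. Let $\alpha$ be uniformly bounded and let $\omega$ be a weight on $G$. If the cone $A_+$ is generating in $A$, then the cone $L^1(G,A,\omega;\alpha)_+$ is generating in $L^1(G,A,\omega;\alpha)$; if $A_+$ is proper, then $L^1(G,A,\omega;\alpha)_+$ is proper. Furthermore, if $A$ is a Banach lattice algebra, then the pre-ordered generalized Beurling algebra $L^1(G,A,\omega;\alpha)$, viewed as pre-ordered Banach space, is a Banach lattice. If, in addition, $\alpha$ lets $G$ act as bipositive isometries on $A$, then the pre-ordered generalized Beurling algebra $L^1(G,A,\omega;\alpha)$ is a Banach lattice algebra.
   Context: All vector spaces are real; algebras are associative and not assumed unital; locally compact groups are Hausdorff. A cone in a vector space $V$ is a subset $C$ with $C+C\subseteq C$ and $\lambda C\subseteq C$ for all $\lambda\ge0$. A pre-ordered vector space is a vector space $V$ with a chosen cone $V_+$; $x\le y$ means $y-x\in V_+$. The cone is proper if $V_+\cap(-V_+)=\{0\}$ and generating if $V=V_+-V_+$. A pre-ordered algebra is an algebra and pre-ordered vector space with $V_+\cdot V_+\subseteq V_+$; a pre-ordered Banach algebra is a pre-ordered algebra that is also a Banach algebra. A Banach lattice is a complete normed vector lattice, i.e. a Banach space with a lattice ordering such that $|x|\le|y|$ implies $\|x\|\le\|y\|$; a Banach lattice algebra is a pre-ordered Banach algebra that is also a Banach lattice. A linear map is bipositive if it is injective, positive, and the preimage of the cone of the target is contained in the cone of the domain.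 $\mathrm{Aut}_+(A)$ is the group of bounded automorphisms $\beta$ of $A$ with $\beta^{\pm1}(A_+)\subseteq A_+$. A pre-ordered Banach algebra dynamical system $(A,G,\alpha)$ consists of a pre-ordered Banach algebra $A$ with closed cone, a locally compact group $G$ and a strongly continuous homomorphism $\alpha:G\to\mathrm{Aut}_+(A)$; $\alpha$ is uniformly bounded if $\sup_{s\in G}\|\alpha_s\|<\infty$. A weight on $G$ is a non-zero submultiplicative Borel measurable function $\omega:G\to[0,\infty)$. $L^1(G,A,\omega)$ is the completion of $C_c(G,A)$ (continuous compactly supported functions) in the norm $\|h\|_{1,\omega}=\int_G\|h(s)\|\omega(s)\,ds$ (left Haar measure), with cone $L^1(G,A,\omega)_+$ the closure of $C_c(G,A_+)$. If $\alpha$ is uniformly bounded, the twisted convolution $(f*g)(s)=\int_Gf(r)\alpha_r(g(r^{-1}s))\,dr$ on $C_c(G,A)$ extends to a continuous multiplication on $L^1(G,A,\omega)$; the resulting pre-ordered algebra, with the norm $\|\cdot\|_{1,\omega}$ (not necessarily submultiplicative) and the same cone, is the pre-ordered generalized Beurling algebra $L^1(G,A,\omega;\alpha)$. *)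

(* Defs.v *)
From HB Require Import structures.
From mathcomp Require Import all_boot all_order all_algebra.
From mathcomp Require Import all_classical all_reals all_analysis.

Set Implicit Arguments.
Unset Strict Implicit.
Unset Printing Implicit Defensive.

Import Order.TTheory GRing.Theory Num.Theory.
Import numFieldNormedType.Exports.

Local Open Scope classical_set_scope.
Local Open Scope ring_scope.

Section Cones.
Variables (R : realType) (V : lmodType R).
Implicit Type C : set V.

Definition is_cone C :=
  [/\ C !=set0, (forall x y, C x -> C y -> C (x + y)) &
      (forall (t : R) x, 0 <= t -> C x -> C (t *: x))].

Definition cone_le C (x y : V) := C (y - x).

Definition proper_cone C := forall x, C x -> C (- x) -> x = 0.

Definition generating_cone C :=
  forall v, exists x y, [/\ C x, C y & v = x - y].

Definition is_sup C (x y z : V) :=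
  [/\ cone_le C x z, cone_le C y z &
      forall w, cone_le C x w -> cone_le C y w -> cone_le C z w].

Definition is_inf C (x y z : V) :=
  [/\ cone_le C z x, cone_le C z y &
      forall w, cone_le C w x -> cone_le C w y -> cone_le C w z].

Definition is_abs C (x a : V) := is_sup C x (- x) a.

Definition vector_lattice C :=
  [/\ is_cone C, proper_cone C &
      forall x y, (exists z, is_sup C x y z) /\ (exists z, is_inf C x y z)].

End Cones.

Definition banach_lattice (R : realType) (V : completeNormedModType R)
    (C : set V) :=
  vector_lattice C /\
  forall x y a b, is_abs C x a -> is_abs C y b -> cone_le C a b ->
    `|x| <= `|y|.

Definition bipositive (R : realType) (V W : lmodType R) (CV : set V)
    (CW : set W) (T : V -> W) :=
  [/\ linear T, injective T, (forall x, CV x -> CW (T x)) &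
      (forall x, CW (T x) -> CV x)].

Definition bilinear_mul (R : realType) (V : lmodType R) (mul : V -> V -> V) :=
  (forall x, linear (mul x)) /\ (forall y, linear (mul^~ y)).

(* Banach algebras need not be unital, so the library's ring structures do not
   apply: the product is an explicit binary operation. *)
Definition banach_algebra (R : realType) (V : completeNormedModType R)
    (mul : V -> V -> V) :=
  [/\ bilinear_mul mul, associative mul &
      forall x y, `|mul x y| <= `|x| * `|y|].

Definition preordered_banach_algebra (R : realType)
    (V : completeNormedModType R) (mul : V -> V -> V) (C : set V) :=
  [/\ banach_algebra mul, is_cone C & forall x y, C x -> C y -> C (mul x y)].

Definition banach_lattice_algebra (R : realType)
    (V : completeNormedModType R) (mul : V -> V -> V) (C : set V) :=
  preordered_banach_algebra mul C /\ banach_lattice C.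

(* Nets are rendered as proper filters on the index type. *)
Definition has_bounded_approx_right_identity (R : realType)
    (V : completeNormedModType R) (mul : V -> V -> V) :=
  exists (I : Type) (F : set_system I) (u : I -> V),
    [/\ ProperFilter F, (exists M : R, forall i, `|u i| <= M) &
        forall a, mul a (u i) @[i --> F] --> a].

(* Membership of [beta] in the group Aut_+(A). *)
Definition positive_automorphism (R : realType) (V : completeNormedModType R)
    (mul : V -> V -> V) (C : set V) (beta : V -> V) :=
  [/\ linear beta, {morph beta : x y / mul x y}, continuous beta &
      exists beta' : V -> V,
        [/\ cancel beta beta', cancel beta' beta, continuous beta',
            (forall x, C x -> C (beta x)) & (forall x, C x -> C (beta' x))]].

HB.mixin Record isTopologicalGroup (G : Type)
    of Group G & PointedTopological G := {
  mulg_continuous : continuous (fun x : G * G => (x.1 * x.2)%g) ;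
  invg_continuous : continuous (fun x : G => (x^-1)%g) }.

(* The distinguished point has no mathematical content: the library's
   generated sigma-algebras require a pointed carrier. *)
#[short(type="topologicalGroupType")]
HB.structure Definition TopologicalGroup :=
  {G of Group G & PointedTopological G & isTopologicalGroup G}.

Definition locally_compact_group (G : topologicalGroupType) :=
  hausdorff_space G /\ locally_compact [set: G].

Notation borel G := (g_sigma_algebraType (@open G)).

Record left_haar_measure (R : realType) (G : topologicalGroupType)
    (mu : {measure set (borel G) -> \bar R}) : Prop := {
  haar_neq0 : mu [set: G] <> 0%E ;
  haar_left_invariant : forall (s : G) (B : set (borel G)), measurable B ->
    mu [set (s * x)%g | x in B] = mu B ;
  haar_compact : forall K : set G, compact K -> (mu K < +oo)%E ;
  haar_outer_regular : forall B : set (borel G), measurable B ->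
    mu B = ereal_inf [set mu U | U in [set U : set G | open U /\ B `<=` U]] ;
  haar_inner_regular : forall U : set G, open U ->
    mu U = ereal_sup [set mu K | K in [set K : set G | compact K /\ K `<=` U]]
}.

Record weight (R : realType) (G : topologicalGroupType) (w : G -> R) : Prop := {
  weight_ge0 : forall s, 0 <= w s ;
  weight_neq0 : exists s, w s != 0 ;
  weight_submul : forall s t, w (s * t)%g <= w s * w t ;
  weight_measurable : measurable_fun [set: borel G] (w : borel G -> R)
}.

Record preordered_dynamical_system (R : realType)
    (A : completeNormedModType R) (mul : A -> A -> A) (Apos : set A)
    (G : topologicalGroupType) (alpha : G -> A -> A) : Prop := {
  pds_algebra : preordered_banach_algebra mul Apos ;
  pds_closed : closed Apos ;
  pds_group : locally_compact_group G ;
  pds_aut : forall s, positive_automorphism mul Apos (alpha s) ;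
  pds_morph : forall s t a, alpha (s * t)%g a = alpha s (alpha t a) ;
  pds_strongly_continuous : forall a, continuous (alpha^~ a)
}.

Definition uniformly_bounded (R : realType) (A : normedModType R) (G : Type)
    (alpha : G -> A -> A) :=
  exists M : R, forall s a, `|alpha s a| <= M * `|a|.

Section CompactlySupported.
Variables (R : realType) (G : topologicalType) (A : normedModType R).

Definition compact_support (f : G -> A) := compact (closure [set s | f s != 0]).

Definition Cc_pred : {pred G -> A} :=
  mem [set f : G -> A | continuous f /\ compact_support f].

Record Cc := MkCc { Cc_fun :> G -> A ; Cc_funP : Cc_fun \in Cc_pred }.

HB.instance Definition _ := [isSub for Cc_fun].
HB.instance Definition _ := [Choice of Cc by <:].

Lemma Cc_submod_closed : submod_closed Cc_pred.
Proof.
split.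
  rewrite inE; split; first by move=> x; exact: cst_continuous.
  rewrite /compact_support (_ : [set _ | _] = set0) ?closure0; first exact: compact0.
  by apply/seteqP; split => x //=; rewrite eqxx.
move=> a f g; rewrite !inE => -[cf sf] [cg sg]; split.
  move=> x; apply: (@continuousD R A G _ g); last exact: cg.
  by apply: continuousZl_tmp; exact: cf.
apply: subclosed_compact (compactU sf sg) _; first exact: closed_closure.
rewrite -closureU; apply: closureS => x /= fgx; apply/orP; apply: contraNT fgx.
rewrite negb_or !negbK => /andP[/eqP fx0 /eqP gx0].
by rewrite fctE /= [a *: f]/(_ *: _) /= fx0 gx0 scaler0 addr0 eqxx.
Qed.

HB.instance Definition _ :=
  GRing.isSubmodClosed.Build R (G -> A) Cc_pred Cc_submod_closed.
HB.instance Definition _ := [SubChoice_isSubLmodule of Cc by <:].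

End CompactlySupported.

(* The integral of a vector-valued function, defined by duality. *)
Definition is_vector_integral (R : realType) (G : topologicalGroupType)
    (mu : {measure set (borel G) -> \bar R}) (A : normedModType R)
    (f : G -> A) (v : A) :=
  forall phi : {scalar A}, continuous phi ->
    mu.-integrable [set: borel G] (fun r => (phi (f r))%:E) /\
    (\int[mu]_(r in [set: borel G]) (phi (f r))%:E = (phi v)%:E)%E.

Section Beurling.
Variables (R : realType) (A : completeNormedModType R) (mul : A -> A -> A).
Variables (Apos : set A) (G : topologicalGroupType) (alpha : G -> A -> A).
Variables (mu : {measure set (borel G) -> \bar R}) (w : G -> R).
Variables (L : completeNormedModType R) (iota : {linear Cc G A -> L}).

Definition norm1w (h : Cc G A) : \bar R :=
  (\int[mu]_(s in [set: borel G]) (`|h s| * w s)%:E)%E.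

(* [L], with [iota], is the completion of [Cc G A] for [norm1w]; this
   determines it up to a unique isometric isomorphism. *)
Record is_L1 : Prop := {
  L1_isometry : forall h, (`|iota h|)%:E = norm1w h ;
  L1_dense : dense (range iota)
}.

Definition L1_cone : set L :=
  closure [set iota h | h in [set h : Cc G A | forall s, Apos (h s)]].

Definition is_twisted_convolution (f g h : Cc G A) :=
  forall s : G,
    is_vector_integral mu (fun r => mul (f r) (alpha r (g (r^-1 * s)%g))) (h s).

Record is_beurling_mul (mulL : L -> L -> L) : Prop := {
  beurling_bilinear : bilinear_mul mulL ;
  beurling_continuous : continuous (fun x : L * L => mulL x.1 x.2) ;
  beurling_extends : forall f g : Cc G A, exists2 h : Cc G A,
    is_twisted_convolution f g h & mulL (iota f) (iota g) = iota h
}.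

End Beurling.

(* Main.v *)
Require Import Defs.
From HB Require Import structures.
From mathcomp Require Import all_boot all_order all_algebra.
From mathcomp Require Import all_classical all_reals all_analysis.
From mathcomp Require Import measurable_realfun ring lra.
Import Order.TTheory GRing.Theory Num.Theory.
Import numFieldNormedType.Exports.
Set Implicit Arguments.
Unset Strict Implicit.
Unset Printing Implicit Defensive.
Local Open Scope classical_set_scope.
Local Open Scope ring_scope.

(** Write [L] for the completion and [iota] for the embedding of the compactly
    supported functions. The assertions are reduced to such functions by density, and
    for them to properties of their values in the algebra.

    Generating cones. Baire's theorem provides a constant [N] such that each vector
    [a] of the algebra is almost a difference of positive vectors of norm at most
    [N * `|a|] ([almost_bounded_decomposition]). A compactly supported function is
    almost a finite combination of its values with coefficients from a partition of
    unity ([cc_approx]), so it inherits such decompositions in the norm of [L], and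
    successive approximation makes them exact ([generating_L1]).

    Proper cones. If [v] and [- v] are limits of positive functions, fast converging
    approximations converge pointwise wherever a certain series is finite; the two
    limits are opposite positive vectors, hence zero, and the norm of the
    approximations of [v] is bounded by the integral of the series, which can be
    chosen as small as one wants ([proper_L1]).

    Lattices. The pointwise absolute value of functions is non-expansive for the
    norm of [L], so it extends to [L], and the inequalities that characterize it
    survive the passage to the limit ([banach_lattice_completion],
    [banach_lattice_L1]).

    Products. By Hahn and Banach, the weakly defined integral satisfies the norm
    estimate [norm_vector_integral] and stays in closed cones
    ([vector_integral_cone]), whence the positivity of the product. Associativity
    and, for isometric actions, submultiplicativity of the norm are exchanges of the
    order of integration. On a group that need not be second countable, whose Haar
    measure need not be sigma-finite, the exchange is proved for jointly continuous
    kernels with compact support, by approximating them with sums of products of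
    functions of one variable ([pfun_fubini]). *)

(** * Norming functionals *)

Section HahnBanach.
Variables (R : realType) (V : normedModType R).
Implicit Types (S : set (V * R)) (x y v : V).

(** Partial linear functionals bounded by the norm are encoded by their graphs,
    linear subspaces of [V * R], so that unions of chains are again such
    graphs. *)
Definition dominated_graph S :=
  (forall (a : R) p q, S p -> S q -> S (a *: p.1 + q.1, a * p.2 + q.2)) /\
  (forall p, S p -> p.2 <= `|p.1|).

Lemma dominated_graph0 S p : dominated_graph S -> S p -> S (0, 0).
Proof.
by move=> [lS _] Sp; have := lS (-1) p p Sp Sp; rewrite scaleN1r mulN1r !addNr.
Qed.

Lemma dominated_graphZ S (a : R) p : dominated_graph S -> S p ->
  S (a *: p.1, a * p.2).
Proof.
move=> dS Sp; have := dS.1 a p _ Sp (dominated_graph0 dS Sp).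
by rewrite !addr0.
Qed.

(** The one-dimensional extension step of Hahn and Banach. Since [r <= `|y|] on
    the graph, every [r - `|y - v|] lies below every [`|y' + v| - r'], and any
    value between the two families can be assigned to [v]; homogeneity reduces
    a general multiple of [v] to the cases [v] and [- v]. *)
Lemma dominated_graph_step S v : dominated_graph S -> S !=set0 ->
  exists c : R, forall p (t : R), S p -> p.2 + t * c <= `|p.1 + t *: v|.
Proof.
move=> dS [p0 Sp0].
pose E := [set p.2 - `|p.1 - v| | p in S].
have key p q : S p -> S q -> p.2 - `|p.1 - v| <= `|q.1 + v| - q.2.
  move=> Sp Sq; rewrite lerBrDr addrAC lerBlDr.
  have := dS.1 1 _ _ Sp Sq; rewrite scale1r mul1r => /dS.2 /= /le_trans; apply.
  have -> : p.1 + q.1 = (q.1 + v) + (p.1 - v) by rewrite addrACA subrr addr0 addrC.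
  exact: ler_normD.
have hsE : has_sup E.
  split; first by exists (p0.2 - `|p0.1 - v|), p0.
  by exists (`|p0.1 + v| - p0.2) => _ [p Sp <-]; exact: key.
have cle p : S p -> p.2 + sup E <= `|p.1 + v|.
  move=> Sp; rewrite addrC -lerBrDr; apply: ge_sup.
    by exists (p0.2 - `|p0.1 - v|), p0.
  by move=> _ [q Sq <-]; exact: key.
have cge p : S p -> p.2 - sup E <= `|p.1 - v|.
  move=> Sp; rewrite lerBlDr -lerBlDl; apply: ub_le_sup; first exact: hsE.2.
  by exists p.
exists (sup E) => p t Sp; have [t0|t0|->] := ltgtP t 0; last first.
- by rewrite mul0r scale0r !addr0; exact: dS.2.
- have := cle _ (dominated_graphZ t^-1 dS Sp).
  rewrite /= -(ler_pM2l t0) mulrDr mulrA mulfV ?gt_eqF// mul1r => /le_trans; apply.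
  rewrite -[X in X * _](gtr0_norm t0) -normrZ scalerDr scalerA mulfV ?gt_eqF//.
  by rewrite scale1r.
- have u0 : 0 < - t by rewrite oppr_gt0.
  have := cge _ (dominated_graphZ (- t)^-1 dS Sp).
  rewrite /= -(ler_pM2l u0) mulrBr mulrA mulfV ?gt_eqF// mul1r mulNr opprK.
  move=> /le_trans; apply.
  rewrite -[X in X * _](gtr0_norm u0) -normrZ scalerBr scalerA mulfV ?gt_eqF//.
  by rewrite scale1r scaleNr opprK.
Qed.

(** The Hahn-Banach theorem for the norm. It is what turns the duality
    definition of the vector-valued integral into norm estimates. *)
Lemma norming_functional v : exists phi : {scalar V},
  [/\ continuous phi, (forall x, `|phi x| <= `|x|) & phi v = `|v|].
Proof.
(* The empty graph is admitted because the empty chain has an empty union; a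
   maximal graph is not empty, as it could be enlarged to [line]. *)
pose P S := dominated_graph S /\ (S = set0 \/ S (v, `|v|)).
have [F FP Ftot|S [[dS Sv] Smax]] := @Zorn_bigcup _ P.
  split; first split.
  - move=> a p q [X FX Xp] [Y FY Yq].
    have [XY|YX] := Ftot _ _ FX FY.
      by exists Y => //; apply: (FP _ FY).1.1 => //; exact: XY.
    by exists X => //; apply: (FP _ FX).1.1 => //; exact: YX.
  - by move=> p [X FX Xp]; exact: (FP _ FX).1.2.
  - have [[X FX Xv]|nex] := pselect (exists2 X, F X & X (v, `|v|)).
      by right; exists X.
    left; apply/seteqP; split => // p [X FX Xp].
    have [X0|Xv] := (FP _ FX).2; first by rewrite X0 in Xp.
    by apply: nex; exists X.
pose line := [set (a *: v, a * `|v|) | a in [set: R]].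
have Pline : P line.
  split; last by right; exists 1; rewrite ?scale1r ?mul1r.
  split.
    move=> a _ _ [b _ <-] [c _ <-] /=; exists (a * b + c) => //.
    by rewrite scalerDl mulrDl scalerA mulrA.
  by move=> _ [a _ <-] /=; rewrite normrZ ler_wpM2r// ler_norm.
have {}Sv : S (v, `|v|).
  case: Sv => // S0; exfalso; apply: (Smax line) => //.
  rewrite S0; split; first exact: sub0set.
  by move=> /(_ (v, `|v|)); apply; exists 1; rewrite ?scale1r ?mul1r.
have dom x : exists r, S (x, r).
  have [//|nx] := pselect (exists r, S (x, r)); exfalso.
  have [c hc] := @dominated_graph_step S x dS (ex_intro _ _ Sv).
  pose S' := [set (p.1.1 + p.2 *: x, p.1.2 + p.2 * c) | p in S `*` [set: R]].
  have SS' p : S p -> S' p.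
    by case: p => y r Sp; exists ((y, r), 0) => //=; rewrite scale0r mul0r !addr0.
  apply: (Smax S'); last first.
    split; last by right; exact: SS'.
    split.
      move=> a _ _ [[p t] [/= Sp _] <-] [[q u] [/= Sq _] <-] /=.
      exists ((a *: p.1 + q.1, a * p.2 + q.2), a * t + u).
        by split => //=; exact: dS.1.
      congr pair => /=.
        by rewrite scalerDr scalerDl scalerA addrACA.
      by rewrite mulrDr mulrDl mulrA addrACA.
    by move=> _ [[p t] [/= Sp _] <-] /=; exact: hc.
  split; first by move=> p; exact: SS'.
  move=> /(_ (x, c)) S'S; apply: nx; exists c; apply: S'S.
  exists ((0, 0), 1) => /=; first by split => //; exact: dominated_graph0 Sv.
  by rewrite scale1r mul1r !add0r.
have uniq x r r' : S (x, r) -> S (x, r') -> r = r'.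
  move=> Sr Sr'; apply/le_anti/andP; split.
    have := dS.2 _ (dS.1 (-1) _ _ Sr' Sr) => /=.
    by rewrite scaleN1r addNr normr0 mulN1r addrC subr_le0.
  have := dS.2 _ (dS.1 (-1) _ _ Sr Sr') => /=.
  by rewrite scaleN1r addNr normr0 mulN1r addrC subr_le0.
pose f x := sval (cid (dom x)).
have Sf x : S (x, f x) by rewrite /f; case: cid.
have flin : linear (f : V -> R^o).
  by move=> a x y; apply: (uniq (a *: x + y)) => //; exact: (dS.1 a _ _ (Sf x) (Sf y)).
pose phi : {scalar V} := HB.pack f (GRing.isLinear.Build R V R^o *%R f flin).
have fle x : `|f x| <= `|x|.
  have fle1 y : f y <= `|y| := dS.2 _ (Sf y).
  rewrite ler_norml lerNl fle1 andbT -(normrN x).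
  by have <- : f (- x) = - f x := raddfN phi x.
exists phi; split => //.
  apply: bounded_linear_continuous; exists 1; split; first exact: real1.
  move=> M M1; near=> x; apply: (le_trans (fle x)); apply/ltW/(lt_trans _ M1).
  by near: x; exact: nbhs0_lt.
by apply: (uniq v).
Unshelve. all: by end_near. Qed.

End HahnBanach.

(** * Cones in normed spaces *)

Lemma subrBB (V : zmodType) (p q s u : V) : p - q - (s - u) = p - s - (q - u).
Proof. by rewrite !opprB addrACA [RHS]addrACA [- q - s]addrC. Qed.

Lemma half_double (R : realType) (V : lmodType R) (x : V) : 2^-1 *: (x + x) = x.
Proof.
by rewrite -mulr2n -[x *+ 2]scaler_nat scalerA mulVf ?scale1r// pnatr_eq0.
Qed.

Section ClosureInNormedSpaces.
Variables (R : realType) (V : normedModType R).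
Implicit Types (S C : set V) (x y v : V).

Lemma closure_normP S v :
  closure S v <-> forall e : R, 0 < e -> exists2 x, S x & `|v - x| < e.
Proof.
split=> [clSv e e0|h B].
  have [x [Sx Bx]] := clSv _ (nbhsx_ballx v e e0).
  by exists x => //; move: Bx; rewrite -ball_normE.
move=> /nbhs_ballP[e /= e0 eB]; have [x Sx vx] := h e e0.
by exists x; split => //; apply: eB; rewrite -ball_normE.
Qed.

Lemma cone0 C : is_cone C -> C 0.
Proof. by move=> [[x Cx] _ CZ]; rewrite -(scale0r x); exact: CZ. Qed.

Lemma cone_sum C (I : Type) (s : seq I) (F : I -> V) : is_cone C ->
  (forall i, C (F i)) -> C (\sum_(i <- s) F i).
Proof.
move=> CC CF; have [_ CD _] := CC.
by apply: (big_ind C) => //; exact: cone0.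
Qed.

(** The arithmetic mean of [z - x] and [z + x] is [z]: this is how positivity
    of an absolute value is recovered from its two defining inequalities. *)
Lemma cone_half C x y : is_cone C -> C x -> C y -> C (2^-1 *: (x + y)).
Proof. by move=> [_ CD CZ] Cx Cy; apply: CZ; [rewrite invr_ge0|exact: CD]. Qed.

Lemma is_cone_closure C : is_cone C -> is_cone (closure C).
Proof.
move=> [[x0 Cx0] CD CZ]; split.
- by exists x0; exact: subset_closure.
- move=> x y /closure_normP clx /closure_normP cly; apply/closure_normP => e e0.
  have e20 : 0 < e / 2 by rewrite divr_gt0.
  have [x' Cx' xx'] := clx _ e20; have [y' Cy' yy'] := cly _ e20.
  exists (x' + y'); first exact: CD.
  by rewrite opprD addrACA (splitr e) (le_lt_trans (ler_normD _ _))// ltrD.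
- move=> t x t0 /closure_normP clx; apply/closure_normP => e e0.
  have t10 : 0 < t + 1 by rewrite ltr_wpDl.
  have [|x' Cx' xx'] := clx (e / (t + 1)); first by rewrite divr_gt0.
  exists (t *: x'); first exact: CZ.
  rewrite -scalerBr normrZ ger0_norm//.
  rewrite (@le_lt_trans _ _ ((t + 1) * `|x - x'|))//.
    by rewrite ler_wpM2r// lerDl.
  by rewrite -ltr_pdivlMl// mulrC.
Qed.

End ClosureInNormedSpaces.

Section VectorLatticeOfAbs.
Variables (R : realType) (V : lmodType R) (K : set V).
Hypothesis coneK : is_cone K.

(** In a vector lattice [x \/ y = (x + y + |x - y|) / 2], so that absolute
    values alone generate the lattice operations. *)
Lemma is_sup_of_abs x y z : is_abs K (x - y) z ->
  is_sup K x y (2^-1 *: (x + y + z)).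
Proof.
have [_ _ KZ] := coneK.
have KZ2 v : K v -> K (2^-1 *: v) by apply: KZ; rewrite invr_ge0.
rewrite /is_abs /is_sup /cone_le => -[h1 h2 h3]; split.
- rewrite -{2}[x]half_double -scalerBr; apply: KZ2.
  have -> // : x + y + z - (x + x) = z - (x - y).
  by rewrite opprB addrAC [x + y]addrC addrKA addrC.
- rewrite -{2}[y]half_double -scalerBr; apply: KZ2.
  have -> // : x + y + z - (y + y) = z - - (x - y).
  by rewrite opprK addrAC addrKA addrC.
- move=> w wx wy; rewrite -[X in K (X - _)]half_double -scalerBr; apply: KZ2.
  rewrite opprD addrA; have [_ KD _] := coneK; apply: h3.
    have -> : w + w - (x + y) - (x - y) = (w - x) + (w - x).
      by rewrite opprB opprD -[LHS]addrA subrKA addrACA.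
    exact: KD.
  have -> : w + w - (x + y) - - (x - y) = (w - y) + (w - y).
    by rewrite opprK [x + y]addrC opprD -[LHS]addrA subrKA addrACA.
  exact: KD.
Qed.

Lemma is_infN x y z : is_sup K (- x) (- y) z -> is_inf K x y (- z).
Proof.
rewrite /is_inf /is_sup /cone_le !opprK => -[h1 h2 h3]; split.
- by rewrite addrC.
- by rewrite addrC.
- by move=> w wx wy; rewrite addrC; apply: h3; rewrite addrC.
Qed.

Lemma vector_lattice_of_abs : proper_cone K ->
  (forall v, exists z, is_abs K v z) -> vector_lattice K.
Proof.
move=> pK absK; split => // x y.
have sup u v : exists z, is_sup K u v z.
  by have [z /is_sup_of_abs] := absK (u - v); eexists; eassumption.
split; first exact: sup.
by have [z /is_infN] := sup (- x) (- y); exists (- z).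
Qed.

End VectorLatticeOfAbs.

Section GeneratingCone.
Variables (R : realType) (V : completeNormedModType R).
Implicit Types (C K : set V).

(** The successive approximation argument of Banach: if every vector is, up to
    an arbitrarily small error, a difference of two controlled positive
    vectors, then decomposing the error again and again, with errors bounded by
    a geometric sequence, gives two norm convergent series of positive terms,
    whose sums remain in the cone because it is closed. *)
Lemma generating_of_approx K (N : R) : is_cone K -> closed K -> 0 <= N ->
  (forall v (e : R), 0 < e -> exists x y,
     [/\ K x, K y, `|x| <= N * `|v| + e, `|y| <= N * `|v| + e &
         `|v - (x - y)| <= e]) ->
  generating_cone K.
Proof.
move=> coneK cK N0 happ v.
pose q n : R := 2^-1 ^+ n.
have q0 n : 0 < q n by rewrite exprn_gt0// invr_gt0.
have qS n : q n.+1 <= q n by rewrite /q exprS ler_piMl; [|exact/ltW/q0|lra].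
have /choice[f hf] (p : nat * V) : exists xy : V * V,
    [/\ K xy.1, K xy.2, `|xy.1| <= N * `|p.2| + q p.1,
        `|xy.2| <= N * `|p.2| + q p.1 & `|p.2 - (xy.1 - xy.2)| <= q p.1].
  by have [x [y ?]] := happ p.2 _ (q0 p.1); exists (x, y).
pose r := fix r n := if n is m.+1 then r m - ((f (m, r m)).1 - (f (m, r m)).2)
                     else v.
pose x n := (f (n, r n)).1; pose y n := (f (n, r n)).2.
have rS n : r n.+1 = r n - (x n - y n) by [].
have Kx n : K (x n) by have [] := hf (n, r n).
have Ky n : K (y n) by have [] := hf (n, r n).
(* All terms and remainders of order [n] are bounded by multiples of [q n]. *)
pose c := N * (`|v| + 2) + 1.
have rle n : `|r n| <= (`|v| + 2) * q n.
  case: n => [|n]; first by rewrite /q expr0 mulr1 lerDl.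
  have [_ _ _ _ /le_trans] := hf (n, r n); rewrite rS; apply.
  have -> : q n = 2 * q n.+1 by rewrite /q exprS mulrA mulfV ?mul1r.
  by rewrite ler_wpM2r ?(ltW (q0 _))// lerDr.
have bound z n : `|z| <= N * `|r n| + q n -> `|z : V| <= c * q n.
  move=> /le_trans; apply.
  by rewrite /c mulrDl mul1r lerD2r -mulrA ler_wpM2l.
have xle n : `|x n| <= c * q n by apply: bound; have [] := hf (n, r n).
have yle n : `|y n| <= c * q n by apply: bound; have [] := hf (n, r n).
have q1 : `|2^-1 : R| < 1 by rewrite ger0_norm ?invr_ge0//; lra.
have cvgs (z : nat -> V) : (forall n, `|z n| <= c * q n) -> cvgn (series z).
  move=> zle; apply: normed_cvg; apply: (@series_le_cvg _ _ (geometric c 2^-1)).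
  - by move=> n; exact: normr_ge0.
  - by move=> n; rewrite /= mulr_ge0 ?(ltW (q0 _))// addr_ge0// mulr_ge0// addr_ge0.
  - exact: zle.
  - exact: is_cvg_geometric_series.
have Klim (z : nat -> V) : (forall n, K (z n)) -> cvgn (series z) ->
    K (limn (series z)).
  move=> Kz cz; apply: (closed_cvg _ cK _ _ cz).
  by apply: nearW => n; exact: cone_sum.
exists (limn (series x)), (limn (series y)); split.
- exact/Klim/cvgs.
- exact/Klim/cvgs.
have sE n : series x n - series y n = v - r n.
  elim: n => [|n IH]; first by rewrite /series/= !big_geq// !subrr.
  by rewrite !seriesSr rS opprD addrACA IH opprB [RHS]addrCA [LHS]addrC.
have rcvg : r @ \oo --> (0 : V).
  apply/cvgr0Pnorm_le => e e0.
  have : (fun n => (`|v| + 2) * q n) @ \oo --> (`|v| + 2) * 0.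
    by apply: cvgMr; exact: cvg_expr.
  rewrite mulr0 => /cvgr0Pnorm_le /(_ e e0); apply: filterS => n /=.
  by move=> /(le_trans (ler_norm _)); apply: le_trans; exact: rle.
have c1 : (fun n => series x n - series y n) @ \oo -->
    limn (series x) - limn (series y).
  by apply: cvgB; exact: cvgs.
have c2 : (fun n => series x n - series y n) @ \oo --> v.
  rewrite (_ : (fun _ => _) = (fun n => v - r n)); last exact/funext.
  by rewrite -[X in _ --> X]subr0; apply: cvgB => //; exact: cvg_cst.
exact: cvg_unique c2 c1.
Qed.

(** An approximate form of Klee's and Ando's theorem. The space is the union of
    the sets [B n] of differences of positive vectors of norm at most [n]; by
    Baire's theorem the closure of one of them contains a ball, hence, [B n]
    being convex and symmetric, a ball around the origin, and homogeneity does
    the rest. *)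
Lemma almost_bounded_decomposition C : is_cone C -> generating_cone C ->
  exists2 N : R, 0 <= N & forall a (e : R), 0 < e -> exists x y,
    [/\ C x, C y, `|x| <= N * `|a|, `|y| <= N * `|a| & `|a - (x - y)| <= e].
Proof.
move=> coneC genC; have [_ CD CZ] := coneC; have C0 := cone0 coneC.
pose B (n : nat) := [set a : V | exists x y,
   [/\ C x, C y, `|x| <= n%:R, `|y| <= n%:R & a = x - y]].
have [n ndense] : exists n, ~ dense (~` closure (B n)).
  apply: contrapT => /forallNP h.
  have /Baire : forall n, open (~` closure (B n)) /\ dense (~` closure (B n)).
    move=> n; split; last exact: contrapT (h n).
    by apply: closed_openC; exact: closed_closure.
  move=> /(_ setT) [||a [_ Fa]]; [by exists 0|exact: openT|].
  have [x [y [Cx Cy axy]]] := genC a.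
  pose n := (Num.truncn (Num.max `|x| `|y|)).+1.
  apply: (Fa n) => //; apply: subset_closure; exists x, y.
  have := truncnS_gt (Num.max `|x| `|y|).
  by rewrite gt_max => /andP[/ltW ? /ltW ?].
have [a0 [r r0 ballB]] : exists a0, exists2 r : R, 0 < r &
    forall a, `|a| < r -> closure (B n) (a0 + a).
  move/denseNE : ndense => -[U [[a0 [oU Ua0]] UB0]].
  have /nbhs_ballP[r /= r0 rU] : nbhs a0 U by exact: open_nbhs_nbhs.
  exists a0, r => // a ar; apply: contrapT => nB.
  rewrite -[False]/(set0 (a0 + a)) -UB0; split => //; apply: rU.
  by rewrite -ball_normE /ball_ /= opprD addrA subrr sub0r normrN.
exists (2 * n%:R / r) => [|a e e0].
  by rewrite divr_ge0// ?mulr_ge0// ltW.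
have [->|a_neq0] := eqVneq a 0.
  by exists 0, 0; rewrite !normr0 mulr0 !subrr normr0; split => //; exact: ltW.
have na0 : 0 < `|a| by rewrite normr_gt0.
(* The scaled vector has norm [r / 2], so that the ball of radius [r]
   applies. *)
pose t := r / 2 / `|a|; have t0 : 0 < t by rewrite !divr_gt0.
have tar : `|t *: a| < r.
  rewrite normrZ gtr0_norm// /t divfK ?gt_eqF// ltr_pdivrMr//.
  by rewrite ltr_pMr// ltr1n.
have te : 0 < t * e by rewrite mulr_gt0.
have [_ [x1 [y1 [Cx1 Cy1 x1n y1n ->]]] d1] := (closure_normP _ _).1 (ballB _ tar) _ te.
have tar' : `|- (t *: a)| < r by rewrite normrN.
have [_ [x2 [y2 [Cx2 Cy2 x2n y2n ->]]] d2] := (closure_normP _ _).1 (ballB _ tar') _ te.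
have scaled u v : `|u| <= n%:R -> `|v| <= n%:R ->
    `|t^-1 *: (2^-1 *: (u + v))| <= 2 * n%:R / r * `|a| :> R.
  move=> un vn; rewrite !normrZ gtr0_norm ?invr_gt0// ger0_norm ?invr_ge0//.
  have -> : 2 * n%:R / r * `|a| = t^-1 * (2^-1 * (n%:R + n%:R)).
    by rewrite /t; field; rewrite !gt_eqF.
  rewrite ler_wpM2l ?invr_ge0 ?(ltW t0)// ler_wpM2l ?invr_ge0//.
  by rewrite (le_trans (ler_normD _ _))// lerD.
exists (t^-1 *: (2^-1 *: (x1 + y2))), (t^-1 *: (2^-1 *: (y1 + x2))); split.
- by apply: CZ; [rewrite invr_ge0 ltW|exact: cone_half].
- by apply: CZ; [rewrite invr_ge0 ltW|exact: cone_half].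
- exact: scaled.
- exact: scaled.
(* Centring at the origin: [t *: a] is half the difference of two points of the
   ball around [a0]. *)
have aE : a = t^-1 *: (2^-1 *: ((a0 + t *: a) - (a0 - t *: a))).
  rewrite opprB addrC addrA subrK -mulr2n -[_ *: a *+ 2]scaler_nat !scalerA.
  by rewrite -[LHS]scale1r; congr (_ *: _); field; rewrite gt_eqF.
rewrite [X in X - _]aE -!scalerBr.
have -> : a0 + t *: a - (a0 - t *: a) - (x1 + y2 - (y1 + x2)) =
    (a0 + t *: a - (x1 - y1)) - (a0 - t *: a - (x2 - y2)).
  have -> : x1 + y2 - (y1 + x2) = x1 - y1 - (x2 - y2).
    by rewrite opprB opprD addrACA.
  exact: subrBB.
rewrite !normrZ gtr0_norm ?invr_gt0// ger0_norm ?invr_ge0//.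
rewrite ler_pdivrMl// ler_pdivrMl// (le_trans (ler_normB _ _))//.
by rewrite mulr_natl mulr2n lerD// ltW.
Qed.

End GeneratingCone.

(** * Lattice structure on a completion *)

(** A dense image of a module [E] with a positive cone [P] and an absolute value
    [J] that is non-expansive and compatible with the norm: [J] then extends to the
    completion, and so does everything that the lattice structure needs. *)
Section CompletionOfNormedLattice.
Variables (R : realType) (E : lmodType R) (V : completeNormedModType R).
Variables (iota : {linear E -> V}) (P : set E) (J : E -> E).
Hypothesis iota_dense : dense (range iota).
Hypothesis coneP : is_cone P.
Hypothesis J_ge : forall f, P (J f - f).
Hypothesis J_geN : forall f, P (J f + f).
Hypothesis J_least : forall f g, P (g - f) -> P (g + f) -> P (g - J f).
Hypothesis norm_J : forall f, `|iota (J f)| = `|iota f|.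
Hypothesis J_lip : forall f g, `|iota (J f - J g)| <= `|iota (f - g)|.
Hypothesis norm_mono : forall f g, P f -> P (g - f) -> `|iota f| <= `|iota g|.

Let K := closure [set iota h | h in P].

Lemma approx_dense v (e : R) : 0 < e -> exists h, `|v - iota h| < e.
Proof.
move=> e0; have ne : (ball v e)^° !=set0 by exists v; exact: nbhsx_ballx.
have [u [vu [h _ hu]]] := iota_dense ne (open_interior _).
by exists h; rewrite hu; move: (interior_subset vu); rewrite -ball_normE.
Qed.

Lemma approx_coneP v :
  K v <-> forall e : R, 0 < e -> exists2 h, P h & `|v - iota h| < e.
Proof.
split=> [/closure_normP Kv e /Kv[_ [h Ph <-]]|Kv]; first by exists h.
by apply/closure_normP => e /Kv[h Ph ?]; exists (iota h) => //; exists h.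
Qed.

Lemma cone_iota h : P h -> K (iota h).
Proof. by move=> Ph; apply: subset_closure; exists h. Qed.

Lemma is_cone_image : is_cone [set iota h | h in P].
Proof.
have [[h0 Ph0] PD PZ] := coneP; split.
- by exists (iota h0), h0.
- move=> _ _ [h Ph <-] [k Pk <-].
  by exists (h + k); [exact: PD|rewrite raddfD].
- move=> t _ t0 [h Ph <-].
  by exists (t *: h); [exact: PZ|rewrite linearZ].
Qed.

Let coneK : is_cone K := is_cone_closure is_cone_image.

(** The graph of the continuous extension of [J]. A relation suffices, as
    absolute values are unique when the cone is proper. *)
Definition abs_limit v z := forall e : R, 0 < e ->
  exists2 h, `|v - iota h| < e & `|z - iota (J h)| < e.

Lemma abs_limit_exists v : exists z, abs_limit v z.
Proof.
have /choice[h hv] (n : nat) : exists h, `|v - iota h| < n.+1%:R^-1.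
  exact: approx_dense.
have close m n : `|iota (J (h m)) - iota (J (h n))| <=
    m.+1%:R^-1 + n.+1%:R^-1 :> R.
  rewrite -raddfB (le_trans (J_lip _ _))// raddfB.
  rewrite (le_trans (ler_distD v _ _))// lerD//.
    rewrite distrC; apply: ltW; exact: hv.
  by apply: ltW; exact: hv.
have cJ : cvgn (fun n => iota (J (h n))).
  apply/cauchy_cvgP/cauchy_exP => e e0.
  have [N Ne] : exists N, N.+1%:R^-1 < e / 2.
    have e20 : 0 < e / 2 by rewrite divr_gt0.
    by have [N] := near_infty_natSinv_lt (PosNum e20) => _ /(_ N (leqnn _)); exists N.
  exists (iota (J (h N))); rewrite /nbhs/=; apply: filterS (nbhs_infty_ge N) => n /= Nn.
  rewrite -ball_normE /= (le_lt_trans (close _ _))// (splitr e) ltrD//.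
  by rewrite (le_lt_trans _ Ne)// lef_pV2 ?posrE// ler_nat.
exists (limn (fun n => iota (J (h n)))) => e e0.
have /cvgrPdist_lt /(_ _ e0) lim_e := cJ.
have [N _ /(_ N (leqnn _)) [/= Ne lN]] :=
  filterI (near_infty_natSinv_lt (PosNum e0)) lim_e.
exists (h N); last exact: lN.
exact: lt_trans (hv N) Ne.
Qed.

Lemma norm_abs_limit v z : abs_limit v z -> `|z| = `|v|.
Proof.
move=> vz; apply/eqP; rewrite -subr_eq0 -normr_le0.
apply/ler_addgt0Pl => e e0; rewrite addr0.
have e20 : 0 < e / 2 by rewrite divr_gt0.
have [h vh zh] := vz _ e20.
have -> : `|z| - `|v| = (`|z| - `|iota (J h)|) - (`|v| - `|iota h|).
  by rewrite norm_J opprB addrA subrK.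
rewrite (le_trans (ler_normB _ _))// (splitr e) lerD//.
  by rewrite (le_trans (ler_dist_dist _ _))// ltW.
by rewrite (le_trans (ler_dist_dist _ _))// ltW.
Qed.

(** Leastness is the point: a bound [u] of [v] and [- v] is approximated by
    the bound [(p + q) / 2] of [(q - p) / 2] in [E], where [p] and [q]
    approximate the positive vectors [u - v] and [u + v]; there [J] is known
    to be least. *)
Lemma is_abs_limit v z : abs_limit v z -> is_abs K v z.
Proof.
move=> vz; rewrite /is_abs /is_sup /cone_le opprK.
split=> [||u].
- apply/approx_coneP => e e0.
  have e20 : 0 < e / 2 by rewrite divr_gt0.
  have [h vh zh] := vz _ e20; exists (J h - h); first exact: J_ge.
  rewrite raddfB subrBB.
  by rewrite (splitr e) (le_lt_trans (ler_normB _ _))// ltrD.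
- apply/approx_coneP => e e0.
  have e20 : 0 < e / 2 by rewrite divr_gt0.
  have [h vh zh] := vz _ e20; exists (J h + h); first exact: J_geN.
  rewrite raddfD opprD addrACA.
  by rewrite (splitr e) (le_lt_trans (ler_normD _ _))// ltrD.
- move=> /approx_coneP Kuv /approx_coneP Kuv'.
  apply/approx_coneP => e e0.
  have e40 : 0 < e / 4 by rewrite divr_gt0.
  have [h vh zh] := vz _ e40.
  have [p Pp up] := Kuv _ e40; have [q Pq uq] := Kuv' _ e40.
  have [_ PD PZ] := coneP.
  pose u' := 2^-1 *: (p + q); pose v' := 2^-1 *: (q - p).
  exists (u' - J v').
    apply: J_least; rewrite /u' /v'.
      by rewrite -scalerBr opprB addrC [p + q]addrC subrKA half_double.
    by rewrite -scalerDr addrC subrKA half_double.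
  have du : `|u - iota u'| < e / 4.
    rewrite /u' linearZ raddfD -[u]half_double -scalerBr normrZ ger0_norm ?invr_ge0//.
    have -> : u + u - (iota p + iota q) = (u - v - iota p) + (u + v - iota q).
      by rewrite [RHS]addrACA -opprD addrACA addNr addr0.
    rewrite ltr_pdivrMl// (le_lt_trans (ler_normD _ _))//.
    by rewrite mulr_natl mulr2n ltrD.
  have dv : `|v - iota v'| < e / 4.
    rewrite /v' linearZ raddfB -[v]half_double -scalerBr normrZ ger0_norm ?invr_ge0//.
    have -> : v + v - (iota q - iota p) = (u + v - iota q) - (u - v - iota p).
      by rewrite [RHS]subrBB [- (u - v)]opprB [u + v + _]addrC subrKA.
    rewrite ltr_pdivrMl// (le_lt_trans (ler_normB _ _))//.
    by rewrite mulr_natl mulr2n ltrD.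
  have dz : `|z - iota (J v')| < e / 4 + (e / 4 + e / 4).
    rewrite (le_lt_trans (ler_distD (iota (J h)) _ _))// ltrD//.
    rewrite -raddfB (le_lt_trans (J_lip _ _))// raddfB.
    by rewrite (le_lt_trans (ler_distD v _ _))// ltrD// distrC.
  rewrite raddfB subrBB (le_lt_trans (ler_normB _ _))//.
  rewrite (lt_le_trans (ltrD du dz))//; lra.
Qed.

Lemma norm_cone_mono a b : K a -> K (b - a) -> `|a| <= `|b|.
Proof.
move=> /approx_coneP Ka /approx_coneP Kba; apply/ler_addgt0Pl => e e0.
have e30 : 0 < e / 3 by rewrite divr_gt0.
have [f Pf af] := Ka _ e30; have [g Pg bg] := Kba _ e30.
have [_ PD _] := coneP.
have fle : `|iota f| <= `|iota (f + g)|.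
  by apply: norm_mono => //; rewrite addrC addKr.
have a1 : `|a| <= `|a - iota f| + `|iota f|.
  by rewrite -[in X in X <= _](subrK (iota f) a) ler_normD.
have b1 : `|iota (f + g)| <= `|b| + (`|a - iota f| + `|b - a - iota g|).
  have -> : iota (f + g) = b - ((a - iota f) + (b - a - iota g)).
    by rewrite addrACA [a + (b - a)]addrC subrK raddfD -opprD subKr.
  by rewrite (le_trans (ler_normB _ _))// lerD2l ler_normD.
lra.
Qed.

Lemma banach_lattice_completion : proper_cone K -> banach_lattice K.
Proof.
move=> pK; have absK v : exists2 z, is_abs K v z & `|z| = `|v|.
  have [z vz] := abs_limit_exists v.
  by exists z; [exact: is_abs_limit|exact: norm_abs_limit].
split.
  by apply: vector_lattice_of_abs => // v; have [z ? _] := absK v; exists z.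
have uniq x a b : is_abs K x a -> is_abs K x b -> a = b.
  move=> [a1 a2 a3] [b1 b2 b3]; apply/eqP; rewrite -subr_eq0; apply/eqP.
  by apply: pK; [exact: b3|rewrite opprB; exact: a3].
have normE x a : is_abs K x a -> `|a| = `|x|.
  by have [z xz <-] := absK x => /uniq /(_ xz) ->.
move=> x y a b xa yb ab; rewrite -(normE _ _ xa) -(normE _ _ yb).
apply: norm_cone_mono => //; have [a1 a2 _] := xa.
have := cone_half coneK a1 a2.
by rewrite opprK addrACA addNr addr0 half_double.
Qed.

End CompletionOfNormedLattice.

(** * Compactly supported functions and partitions of unity *)

Section CompactlySupportedFunctions.
Variables (R : realType) (T : topologicalType).

(** Requiring the function to vanish off some compact set, instead of bounding
    its closed support, lets stability properties be read off from unions and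
    images of compact sets. *)
Definition cc (V : normedModType R) (f : T -> V) :=
  continuous f /\ exists2 K, compact K & forall t, ~ K t -> f t = 0.

Lemma cc_of_Cc (V : normedModType R) (f : Cc T V) : cc f.
Proof.
case: f => f /=; rewrite inE => -[cf sf]; split => //.
exists (closure [set t | f t != 0]) => // t nt; apply/eqP; apply: contrapT => ft.
by apply: nt; apply: subset_closure; exact/negP.
Qed.

Lemma exists_Cc (V : normedModType R) (f : T -> V) : hausdorff_space T -> cc f ->
  exists h : Cc T V, h =1 f.
Proof.
move=> hT [cf [K cK fK]].
suff fP : f \in @Cc_pred R T V by exists (MkCc fP).
rewrite inE; split => //; apply: (subclosed_compact _ cK).
  exact: closed_closure.
have /closure_id -> := compact_closed hT cK; apply: closureS => t /= /eqP ft.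
by apply: contrapT => /fK.
Qed.

Lemma cc_comp (V W : normedModType R) (f : T -> V) (g : V -> W) :
  cc f -> continuous g -> g 0 = 0 -> cc (g \o f).
Proof.
move=> [cf [K cK fK]] cg g0; split.
  by move=> t; apply: continuous_comp; [exact: cf|exact: cg].
by exists K => // t /fK /= ->.
Qed.

Lemma cc_scale (V : normedModType R) (f : T -> R) (g : T -> V) :
  cc f -> continuous g -> cc (fun t => f t *: g t).
Proof.
move=> [cf [K cK fK]] cg; split; first by move=> t; apply: cvgZ; [exact: cf|exact: cg].
by exists K => // t /fK ->; rewrite scale0r.
Qed.

Lemma cc_mull (f : T -> R) (g : T -> R) :
  cc (f : T -> R^o) -> continuous g -> cc ((fun t => f t * g t) : T -> R^o).
Proof. exact: (@cc_scale R^o). Qed.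

Lemma cc_mulr (f : T -> R) (g : T -> R) :
  continuous f -> cc (g : T -> R^o) -> cc ((fun t => f t * g t) : T -> R^o).
Proof.
move=> cf cg; rewrite (_ : (fun _ => _) = (fun t => g t * f t)).
  exact: cc_mull.
by apply/funext => t; rewrite mulrC.
Qed.

Lemma cc_norm (V : normedModType R) (f : T -> V) :
  cc f -> cc ((fun t => `|f t|) : T -> R^o).
Proof.
move=> cf; apply: (@cc_comp V R^o _ (fun v => `|v|) cf); last exact: normr0.
by move=> v; exact: norm_continuous.
Qed.

Lemma cc0 (V : normedModType R) : cc (fun _ : T => 0 : V).
Proof.
split; first by move=> t; exact: cvg_cst.
by exists set0 => //; exact: compact0.
Qed.

Lemma cc_add (V : normedModType R) (f g : T -> V) :
  cc f -> cc g -> cc (fun t => f t + g t).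
Proof.
move=> [cf [K cK fK]] [cg [K' cK' gK']]; split.
  by move=> t; apply: cvgD; [exact: cf|exact: cg].
exists (K `|` K'); first exact: compactU.
by move=> t /not_orP[/fK -> /gK' ->]; rewrite addr0.
Qed.

Lemma cc_sub (V : normedModType R) (f g : T -> V) :
  cc f -> cc g -> cc (fun t => f t - g t).
Proof.
move=> cf cg; apply: cc_add => //.
by apply: (cc_comp cg (g := -%R)); [exact: opp_continuous|exact: oppr0].
Qed.

Lemma cc_sum (V : normedModType R) (I : Type) (s : seq I) (f : I -> T -> V) :
  (forall i, cc (f i)) -> cc (fun t => \sum_(i <- s) f i t).
Proof.
move=> cf; elim: s => [|i s IH].
  by under eq_fun do rewrite big_nil; exact: cc0.
by under eq_fun do rewrite big_cons; exact: cc_add.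
Qed.

End CompactlySupportedFunctions.

Section PartitionOfUnity.
Variables (R : realType) (T : ptopologicalType).
Hypothesis hausT : hausdorff_space T.
Hypothesis lcT : locally_compact [set: T].

(** Locally compact Hausdorff spaces are completely regular, and a function
    separating a point from the complement of a compact neighbourhood has
    compact support. *)
Lemma bump_at (x : T) (Q : set T) : nbhs x Q -> exists b : T -> R,
  [/\ cc (b : T -> R^o), (forall t, 0 <= b t), b x = 1 &
      forall t, b t != 0 -> Q t].
Proof.
move=> Qx; have [U xU [cU clU]] := @lcT x I.
have xQU : nbhs x (Q `&` U).
  by apply: filterI => //; move: xU; rewrite /= withinET.
pose O := (Q `&` U)°.
have nxO : ~ (~` O) x by move=> /(_ xQU).
have clO : closed (~` O) by apply: open_closedC; exact: open_interior.
have /uniform_separatorP := @locally_compact_completely_regular T R lcT hausT x _ clO nxO.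
move=> /(_ R)[f [cf f01 fx fO]].
have fO1 t : ~ O t -> f t = 1 by move=> nO; apply: fO; exists t.
exists (fun t => 1 - f t); split.
- split; first by move=> t; apply: cvgB; [exact: cvg_cst|exact: cf].
  exists U => // t nU; rewrite fO1 ?subrr// => /interior_subset[_].
  exact: nU.
- move=> t; have : range f (f t) by exists t.
  by move=> /f01; rewrite /= in_itv/= subr_ge0 => /andP[].
- have /fx /= -> : [set f y | y in [set x]] (f x) by exists x.
  by rewrite subr0.
- move=> t; apply: contraNP => nQ; rewrite fO1 ?subrr//.
  by move=> /interior_subset[].
Qed.

(** Finitely many bumps exceed [1 / 2] somewhere at each point of [K]. Dividing
    by the maximum of their sum and [1 / 2], instead of the sum itself, keeps
    the quotients continuous everywhere and changes nothing on [K]. *)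
Lemma partition_of_unity (K : set T) (Q : T -> set T) : compact K ->
  (forall x, K x -> nbhs x (Q x)) ->
  exists (s : seq T) (phi : T -> T -> R),
    [/\ (forall i, cc (phi i : T -> R^o)), (forall i t, 0 <= phi i t),
        (forall i t, phi i t != 0 -> Q i t),
        (forall t, \sum_(i <- s) phi i t <= 1) &
        forall t, K t -> \sum_(i <- s) phi i t = 1].
Proof.
move=> cK hQ.
have /choice[b hb] (x : T) : exists b : T -> R, [/\ cc (b : T -> R^o),
    (forall t, 0 <= b t), K x -> b x = 1 & forall t, b t != 0 -> Q x t].
  have [Kx|nKx] := pselect (K x).
    by have [b [? ? ? ?]] := bump_at (hQ x Kx); exists b.
  by exists (fun=> 0); split => //; [exact: cc0|move=> t; rewrite eqxx].
have cb i : continuous (b i) by have [[]] := hb i.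
have b0 i t : 0 <= b i t by have [] := hb i.
have covK : cover_compact K by rewrite -compact_cover.
have [||D' DK KD] := covK T K (fun x => [set t | 2^-1 < b x t]).
- move=> x _; have -> : [set t | 2^-1 < b x t] = b x @^-1` [set r | 2^-1 < r] by [].
  by apply: open_comp; [move=> t _; exact: cb|exact: open_gt].
- move=> x Kx; exists x => //=; have [_ _ -> // _] := hb x.
  by rewrite invf_lt1// ltr1n.
pose s : seq T := finmap.enum_fset D'.
pose D t := \sum_(i <- s) b i t.
pose m t := Num.max (D t) 2^-1.
have m0 t : 0 < m t by rewrite lt_max invr_gt0 ltr0n orbT.
have cD : continuous D by apply: (@cc_sum R T R^o _ _ b _).1 => i; have [] := hb i.
have cm : continuous m.
  by move=> t; apply: continuous_max; [exact: cD|exact: cvg_cst].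
have sumE t : \sum_(i <- s) b i t / m t = D t / m t by rewrite mulr_suml.
exists s, (fun i t => b i t / m t); split.
- move=> i; apply: (@cc_mull R T (b i)); first by have [] := hb i.
  by move=> t; apply: cvgV; [rewrite gt_eqF|exact: cm].
- by move=> i t; rewrite divr_ge0// ltW.
- move=> i t bi; have [_ _ _] := hb i; apply.
  by apply: contra_neq bi => ->; rewrite mul0r.
- by move=> t; rewrite sumE ler_pdivrMr// mul1r le_max lexx.
- move=> t Kt; rewrite sumE; suff mD : m t = D t by rewrite -mD divff// gt_eqF.
  have [x xD' /= bx] := KD t Kt; apply: max_l.
  rewrite /D (big_rem x)//= (le_trans (ltW bx))// lerDl.
  by apply: sumr_ge0 => i _.
Qed.

End PartitionOfUnity.

(** * Positive functionals and iterated integrals *)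

Notation ccR f := (cc (f : _ -> _^o)).

Section PositiveFunctionals.
Variables (R : realType) (T : topologicalType).

(** Radon measures enter only through the functionals that they define on
    compactly supported continuous functions. This avoids measurability on
    the product of two groups, where the Borel sets need not be generated by
    boxes. *)
Record positive_functional (I : (T -> R) -> R) : Prop := {
  pfunD : forall f g, ccR f -> ccR g -> I (fun t => f t + g t) = I f + I g ;
  pfunZ : forall (a : R) f, ccR f -> I (fun t => a * f t) = a * I f ;
  pfun_ge0 : forall f, ccR f -> (forall t, 0 <= f t) -> 0 <= I f }.

Variable I : (T -> R) -> R.
Hypothesis hI : positive_functional I.

Lemma ccRZ (a : R) (f : T -> R) : ccR f -> ccR (fun t => a * f t).
Proof. by move=> cf; apply: cc_mulr => // t; exact: cvg_cst. Qed.

Lemma pfun0 : I (fun=> 0) = 0.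
Proof.
have := pfunZ hI 0 (cc0 T R^o); rewrite [RHS]mul0r; apply: etrans; congr I.
by apply/funext => t; rewrite mul0r.
Qed.

Lemma pfunB f g : ccR f -> ccR g -> I (fun t => f t - g t) = I f - I g.
Proof.
move=> cf cg; rewrite -[in RHS]mulN1r -pfunZ// -pfunD//; last exact: ccRZ.
by congr I; apply/funext => t; rewrite mulN1r.
Qed.

Lemma pfun_sum (A : Type) (s : seq A) (f : A -> T -> R) :
  (forall i, ccR (f i)) -> I (fun t => \sum_(i <- s) f i t) = \sum_(i <- s) I (f i).
Proof.
move=> cf; elim: s => [|i s IH].
  rewrite big_nil -[RHS]pfun0; congr I.
  by apply/funext => t; rewrite big_nil.
rewrite big_cons -IH -pfunD//; last exact: (@cc_sum R T R^o).
by congr I; apply/funext => t; rewrite big_cons.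
Qed.

Lemma le_pfun f g : ccR f -> ccR g -> (forall t, f t <= g t) -> I f <= I g.
Proof.
move=> cf cg fg; rewrite -subr_ge0 -pfunB//; apply: pfun_ge0 => //.
  exact: (@cc_sub R T R^o).
by move=> t; rewrite subr_ge0.
Qed.

Lemma pfun_dist f g u : ccR f -> ccR g -> ccR u ->
  (forall t, `|f t - g t| <= u t) -> `|I f - I g| <= I u.
Proof.
move=> cf cg cu fgu; rewrite -pfunB// ler_norml -mulN1r -pfunZ//.
have cfg : ccR (fun t => f t - g t) by exact: (@cc_sub R T R^o).
by apply/andP; split; apply: le_pfun => //; first exact: ccRZ;
   move=> t; have := fgu t; rewrite ler_norml => /andP[]; rewrite ?mulN1r.
Qed.

End PositiveFunctionals.

Section Approximation.
Variables (R : realType) (T : ptopologicalType).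
Hypothesis hausT : hausdorff_space T.
Hypothesis lcT : locally_compact [set: T].

Lemma bump_on (K : set T) : compact K -> exists u : T -> R,
  [/\ ccR u, (forall t, 0 <= u t) & forall t, K t -> u t = 1].
Proof.
move=> cK.
have [|s [phi [cphi phi0 _ _ phi1]]] :=
    @partition_of_unity R T hausT lcT K (fun=> setT) cK.
  by move=> x _; exact: filterT.
exists (fun t => \sum_(i <- s) phi i t); split => //.
  exact: (@cc_sum R T R^o).
by move=> t; apply: sumr_ge0.
Qed.

(** The function [u] does not depend on the cover: it bounds the mass of every
    partition, so that a uniform error [e] integrates to at most [e] times a
    constant fixed in advance. *)
Lemma dominated_partition_of_unity (K : set T) : compact K ->
  exists u : T -> R, [/\ ccR u, (forall t, 0 <= u t) &
  forall Q : T -> set T, (forall x, K x -> nbhs x (Q x)) ->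
  exists (s : seq T) (phi : T -> T -> R),
    [/\ (forall i, ccR (phi i)), (forall i t, 0 <= phi i t),
        (forall i t, phi i t != 0 -> Q i t),
        (forall t, \sum_(i <- s) phi i t <= Num.min 1 (u t)) &
        forall t, K t -> \sum_(i <- s) phi i t = 1]].
Proof.
move=> cK; have [u [cu u0 u1]] := bump_on cK.
(* The members of the partition live where [u > 1 / 2], hence the factor
   two. *)
exists (fun t => 2 * u t); split; first exact: ccRZ.
  by move=> t; rewrite mulr_ge0.
move=> Q hQ.
have [|s [phi [cphi phi0 phiQ phi1 phiK]]] :=
    @partition_of_unity R T hausT lcT K (fun x => Q x `&` [set t | 2^-1 < u t]) cK.
  move=> x Kx; apply: filterI; first exact: hQ.
  apply: open_nbhs_nbhs; split.
    have -> : [set t | 2^-1 < u t] = u @^-1` [set r | 2^-1 < r] by [].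
    by apply: open_comp; [move=> t _; exact: cu.1|exact: open_gt].
  by rewrite /= u1// invf_lt1// ltr1n.
exists s, phi; split => //; first by move=> i t /phiQ[].
move=> t; rewrite le_min phi1/=.
have [ut|ut] := ltP 2^-1 (u t).
  by rewrite (le_trans (phi1 t))// -ler_pdivrMl// mulr1 ltW.
rewrite big1 ?mulr_ge0// => i _; apply/eqP; apply: contraLR ut => /phiQ[_ /=].
by rewrite -ltNge.
Qed.

(** A compactly supported vector-valued function is approximated by
    combinations of its values with scalar coefficients, uniformly up to the
    fixed dominating function [u]; the coefficients vary over balls where [f]
    is almost constant. *)
Lemma cc_approx (V : normedModType R) (f : T -> V) : cc f ->
  exists u : T -> R, [/\ ccR u, (forall t, 0 <= u t) &
  forall e : R, 0 < e -> exists (s : seq T) (phi : T -> T -> R),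
    [/\ (forall i, ccR (phi i)), (forall i t, 0 <= phi i t),
        (forall t, `|f t - \sum_(i <- s) phi i t *: f i| <= e * u t),
        (forall t, \sum_(i <- s) phi i t * `|f i| <= `|f t| + e * u t) &
        (forall t, \sum_(i <- s) phi i t <= u t)]].
Proof.
move=> [cf [K cK fK]]; have [u [cu u0 hu]] := dominated_partition_of_unity cK.
exists u; split => // e e0.
have [|s [phi [cphi phi0 phiQ phi1 phiK]]] := hu (fun x => [set t | `|f t - f x| < e]).
  move=> x _; have /cvgrPdist_lt /(_ e e0) := cf x.
  by apply: filterS => t; rewrite distrC.
exists s, phi; split => // t.
- have {1}-> : f t = \sum_(i <- s) phi i t *: f t.
    rewrite -scaler_suml; have [Kt|nKt] := pselect (K t).
      by rewrite phiK// scale1r.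
    by rewrite fK// scaler0.
  rewrite -sumrB; apply: le_trans (ler_norm_sum _ _ _) _.
  apply: (@le_trans _ _ (\sum_(i <- s) phi i t * e)).
    apply: ler_sum => i _; rewrite -scalerBr normrZ ger0_norm//.
    have [->|/phiQ /ltW] := eqVneq (phi i t) 0; first by rewrite !mul0r.
    by move=> h; rewrite ler_wpM2l.
  rewrite -mulr_suml mulrC ler_wpM2l ?(ltW e0)//.
  by rewrite (le_trans (phi1 t))// ge_min lexx orbT.
- apply: (@le_trans _ _ (\sum_(i <- s) (phi i t * `|f t| + phi i t * e))).
  apply: ler_sum => i _; rewrite -mulrDr.
  have [->|/phiQ /ltW h] := eqVneq (phi i t) 0; first by rewrite !mul0r.
  rewrite ler_wpM2l// -lerBlDl (le_trans (lerB_dist _ _))//.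
  by rewrite distrC.
  rewrite big_split/= -!mulr_suml lerD//.
    by rewrite ler_piMl// (le_trans (phi1 t))// ge_min lexx.
  rewrite mulrC ler_wpM2l ?(ltW e0)//.
  by rewrite (le_trans (phi1 t))// ge_min lexx orbT.
- by rewrite (le_trans (phi1 t))// ge_min lexx orbT.
Qed.

End Approximation.

Section FubiniForPositiveFunctionals.
Variables (R : realType) (T : ptopologicalType).
Hypothesis hausT : hausdorff_space T.
Hypothesis lcT : locally_compact [set: T].

(** The tube lemma: a jointly continuous kernel is continuous in one variable
    uniformly over a compact set of values of the other. *)
Lemma tube_dist (F : T -> T -> R) (K : set T) (r : T) (e : R) :
  continuous (fun p : T * T => F p.1 p.2) -> compact K -> 0 < e ->
  \forall r' \near r, forall s, K s -> `|F r' s - F r s| < e.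
Proof.
move=> cF /compact_near_coveringP cK e0.
apply: (cK _ (nbhs r) (fun r' s => `|F r' s - F r s| < e)) => s Ks.
have e20 : 0 < e / 2 by rewrite divr_gt0.
have near_rs : \forall s' \near s & r' \near r, `|F r s - F r' s'| < e / 2.
  have /cvgrPdist_lt /(_ _ e20) [[U V] /= [rU sV] UV] := cF (r, s).
  by exists (V, U) => // -[s' r'] [/= ? ?]; exact: (UV (r', s')).
have near_s : \forall s' \near s & r' \near r, `|F r s - F r s'| < e / 2.
  move: near_rs => [[V U] /= [sV rU] UV].
  exists (V, U) => // -[s' r'] [/= Vs' _]; apply: (UV (s', r)); split => //.
  exact: nbhs_singleton.
apply: filterS2 near_rs near_s => -[s' r'] /= h1 h2.
by rewrite (le_lt_trans (ler_distD (F r s) _ _))// (splitr e) ltrD// distrC.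
Qed.

Section Kernel.
Variables (I J : (T -> R) -> R) (F : T -> T -> R) (K1 K2 : set T).
Hypothesis hI : positive_functional I.
Hypothesis hJ : positive_functional J.
Hypothesis cF : continuous (fun p : T * T => F p.1 p.2).
Hypotheses (cK1 : compact K1) (cK2 : compact K2).
Hypothesis FK1 : forall r s, ~ K1 r -> F r s = 0.
Hypothesis FK2 : forall r s, ~ K2 s -> F r s = 0.

Lemma cc_kernel r : ccR (F r).
Proof.
split; last by exists K2 => // s; exact: FK2.
move=> s; apply: (@continuous_comp _ _ _ (fun s => (r, s)) (fun p => F p.1 p.2)).
  by apply: cvg_pair => /=; [exact: cvg_cst|exact: cvg_id].
exact: cF.
Qed.

Lemma cc_pfun_kernel : ccR (fun r => J (F r)).
Proof.
have [v [cv v0 v1]] := @bump_on R T hausT lcT K2 cK2.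
split; last first.
  exists K1 => // r nKr; rewrite -(pfun0 hJ); congr J.
  by apply/funext => s; rewrite FK1.
move=> r; apply/cvgrPdist_le => e e0.
have Jv0 : 0 < J v + 1 by rewrite ltr_wpDl// pfun_ge0.
have d0 : 0 < e / (J v + 1) by rewrite divr_gt0.
have := tube_dist r cF cK2 d0; apply: filterS => r' hr'.
apply: (@le_trans _ _ (e / (J v + 1) * J v)); last first.
  by rewrite mulrAC ler_pdivrMr// ler_wpM2l ?(ltW e0)// lerDl.
rewrite -pfunZ//; apply: pfun_dist => //; [exact: cc_kernel..|exact: ccRZ|].
move=> s; have [Ks|nKs] := pselect (K2 s).
  by rewrite v1// mulr1 distrC ltW// hr'.
by rewrite !FK2// subrr normr0 mulr_ge0// ltW.
Qed.

(** A compactly supported kernel is, up to an error dominated by a fixed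
    product [u r * v s], a finite sum of products of functions of one
    variable. *)
Lemma kernel_approx : exists u v : T -> R,
  [/\ ccR u, ccR v, (forall t, 0 <= u t), (forall t, 0 <= v t) &
  forall e : R, 0 < e -> exists (l : seq T) (phi : T -> T -> R),
    (forall i, ccR (phi i)) /\
    (forall r s, `|F r s - \sum_(i <- l) phi i r * F i s| <= e * u r * v s)].
Proof.
have [v [cv v0 v1]] := @bump_on R T hausT lcT K2 cK2.
have [u [cu u0 hu]] := @dominated_partition_of_unity R T hausT lcT K1 cK1.
exists u, v; split => // e e0.
have [|l [phi [cphi phi0 phiQ phi1 phiK]]] :=
    hu (fun x => [set t | forall s, K2 s -> `|F t s - F x s| < e]).
  by move=> x _; exact: tube_dist.
exists l, phi; split => // r s.
have {1}-> : F r s = \sum_(i <- l) phi i r * F r s.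
  rewrite -mulr_suml; have [Kt|nKt] := pselect (K1 r).
    by rewrite phiK// mul1r.
  by rewrite FK1// mulr0.
rewrite -sumrB; apply: le_trans (ler_norm_sum _ _ _) _.
apply: (@le_trans _ _ (\sum_(i <- l) phi i r * (e * v s))).
  apply: ler_sum => i _; rewrite -mulrBr normrM ger0_norm//.
  have [->|/phiQ h] := eqVneq (phi i r) 0; first by rewrite !mul0r.
  rewrite ler_wpM2l//; have [Ks|nKs] := pselect (K2 s).
    by rewrite v1// mulr1 ltW// h.
  by rewrite !FK2// subrr normr0 mulr_ge0// ltW.
rewrite -mulr_suml mulrCA -mulrA ler_wpM2l ?(ltW e0)// ler_wpM2r//.
by rewrite (le_trans (phi1 r))// ge_min lexx orbT.
Qed.

End Kernel.

(** Both iterated integrals are close to the common value on the finite sums of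
    [kernel_approx], for which the order of integration obviously does not
    matter. *)
Lemma pfun_fubini (I J : (T -> R) -> R) (F : T -> T -> R) (K1 K2 : set T) :
  positive_functional I -> positive_functional J ->
  continuous (fun p : T * T => F p.1 p.2) -> compact K1 -> compact K2 ->
  (forall r s, ~ K1 r -> F r s = 0) -> (forall r s, ~ K2 s -> F r s = 0) ->
  I (fun r => J (F r)) = J (fun s => I (F^~ s)).
Proof.
move=> hI hJ cF cK1 cK2 FK1 FK2.
have cF' : continuous (fun p : T * T => F p.2 p.1).
  move=> p; apply: (@continuous_comp _ _ _ (fun p : T * T => (p.2, p.1)) (fun p => F p.1 p.2)).
    by apply: cvg_pair => /=; [exact: cvg_snd|exact: cvg_fst].
  exact: cF.
have cg : ccR (fun r => J (F r)) by exact: cc_pfun_kernel cK2 FK1 FK2.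
have ck : ccR (fun s => I (F^~ s)).
  by apply: (cc_pfun_kernel (F := fun s r => F r s) hI cF' cK2 cK1) => *; [exact: FK2|exact: FK1].
have cFl r : ccR (F r) by exact: (cc_kernel cF cK2 FK2).
have cFr s : ccR (F^~ s).
  by apply: (cc_kernel (F := fun s r => F r s) cF' cK1) => *; exact: FK1.
have [u [v [cu cv u0 v0 huv]]] := kernel_approx cF cK1 cK2 FK1 FK2.
apply/eqP; rewrite -subr_eq0 -normr_le0; apply/ler_addgt0Pr => e e0; rewrite add0r.
have Iu : 0 <= I u by exact: pfun_ge0.
have Jv : 0 <= J v by exact: pfun_ge0.
(* Each of the two comparisons with [m] costs at most [d * (I u * J v)], which
   is at most [e / 2]. *)
pose d := e / (2 * (I u * J v + 1)).
have c0 : 0 < I u * J v + 1 by rewrite ltr_wpDl// mulr_ge0.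
have d0 : 0 < d by rewrite divr_gt0// mulr_gt0.
have [l [phi [cphi hphi]]] := huv d d0.
pose m := \sum_(i <- l) I (phi i) * J (F i).
have h1 : `|I (fun r => J (F r)) - m| <= d * (I u * J v).
  have -> : m = I (fun r => \sum_(i <- l) J (F i) * phi i r).
    rewrite pfun_sum//; last by move=> i; exact: ccRZ.
    by apply: eq_bigr => i _; rewrite pfunZ// mulrC.
  have -> : d * (I u * J v) = I (fun r => d * J v * u r).
    by rewrite pfunZ//; ring.
  apply: pfun_dist => //; [|exact: ccRZ|].
    by apply: (@cc_sum R T R^o) => i; exact: ccRZ.
  move=> r.
  have -> : \sum_(i <- l) J (F i) * phi i r = J (fun s => \sum_(i <- l) phi i r * F i s).
    rewrite pfun_sum//; last by move=> i; exact: ccRZ.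
    by apply: eq_bigr => i _; rewrite pfunZ// mulrC.
  have -> : d * J v * u r = J (fun s => d * u r * v s) by rewrite pfunZ// mulrAC.
  apply: pfun_dist => //; [|exact: ccRZ].
  by apply: (@cc_sum R T R^o) => i; exact: ccRZ.
have h2 : `|J (fun s => I (F^~ s)) - m| <= d * (I u * J v).
  have -> : m = J (fun s => \sum_(i <- l) I (phi i) * F i s).
    rewrite pfun_sum//; last by move=> i; exact: ccRZ.
    by apply: eq_bigr => i _; rewrite pfunZ.
  have -> : d * (I u * J v) = J (fun s => d * I u * v s).
    by rewrite pfunZ//; ring.
  apply: pfun_dist => //; [|exact: ccRZ|].
    by apply: (@cc_sum R T R^o) => i; exact: ccRZ.
  move=> s.
  have -> : \sum_(i <- l) I (phi i) * F i s = I (fun r => \sum_(i <- l) F i s * phi i r).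
    rewrite pfun_sum//; last by move=> i; exact: ccRZ.
    by apply: eq_bigr => i _; rewrite pfunZ// mulrC.
  have -> : d * I u * v s = I (fun r => d * v s * u r) by rewrite pfunZ// mulrAC.
  apply: pfun_dist => //; [|exact: ccRZ|].
    by apply: (@cc_sum R T R^o) => i; exact: ccRZ.
  move=> r; rewrite mulrAC.
  by under eq_bigr do rewrite mulrC; exact: hphi.
have h3 : d * (I u * J v) <= e / 2.
  have -> : e / 2 = d * (I u * J v + 1) by rewrite /d; field; rewrite gt_eqF.
  by rewrite ler_wpM2l ?(ltW d0)// lerDl.
rewrite (le_trans (ler_distD m _ _))// [X in _ <= X](splitr e) lerD//.
  exact: le_trans h3.
by rewrite distrC; exact: le_trans h3.
Qed.

End FubiniForPositiveFunctionals.

(** * Integration against Borel and Haar measures *)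

Lemma open_borel (T : ptopologicalType) (U : set T) : open U -> measurable (U : set (borel T)).
Proof. by move=> oU; apply: sub_sigma_algebra. Qed.

Lemma continuous_borel_measurable (R : realType) (T : ptopologicalType)
    (f : T -> R) : continuous f ->
  measurable_fun [set: borel T] (f : borel T -> R).
Proof.
move=> cf; apply: (measurability _ (RGenOInfty.measurableE R)).
move=> _ [_ [x ->] <-]; rewrite setTI; apply: open_borel.
by apply: open_comp; [move=> t _; exact: cf|exact: interval_open].
Qed.

Lemma continuous_borel_comp (S T : ptopologicalType) (f : S -> T) : continuous f ->
  measurable_fun [set: borel S] (f : borel S -> borel T).
Proof.
move=> cf; apply: (@measurability _ _ (borel S) (borel T) _ _ (@open T)) => //.
move=> _ [U oU <-]; rewrite setTI; apply: open_borel.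
by apply: open_comp => // t _; exact: cf.
Qed.

Lemma compact_borel (T : ptopologicalType) (K : set T) : hausdorff_space T -> compact K ->
  measurable (K : set (borel T)).
Proof.
move=> hT /(compact_closed hT) clK; rewrite -[K]setCK.
by apply: measurableC; apply: open_borel; rewrite openC.
Qed.

Section BorelIntegration.
Variables (R : realType) (T : ptopologicalType).
Variable mu : {measure set (borel T) -> \bar R}.

Lemma cc_integral_fin (f : T -> R) : hausdorff_space T ->
  (forall K : set T, compact K -> (mu K < +oo)%E) -> ccR f ->
  mu.-integrable [set: borel T] (fun t => (f t)%:E).
Proof.
move=> hT mufin [cf [K cK fK]].
have mK := compact_borel hT cK.
have -> : (fun t : borel T => (f t)%:E) = (fun t : borel T => (f t)%:E) \_ K.
  apply/funext => t; rewrite patchE; case: ifPn => // /negP nKt.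
  by rewrite fK// => Kt; apply: nKt; rewrite inE.
apply/(integrable_mkcond _ mK).
apply: measurable_bounded_integrable => //; first exact: mufin.
  by apply: measurable_funTS; apply: continuous_borel_measurable; exact: cf.
have /compact_bounded[M [_ fM]] : compact (f @` K).
  by apply: continuous_compact => //; exact: continuous_subspaceT cf.
by exists M; split; [exact: num_real|move=> ? ? t Kt; apply: fM => //; exists t].
Qed.

(** The conditions under which the weighted measure defines a positive
    functional on compactly supported functions. *)
Definition admissible_weight (w : T -> R) :=
  [/\ measurable_fun [set: borel T] (w : borel T -> R), (forall t, 0 <= w t) &
      forall f : T -> R, ccR f -> (forall t, 0 <= f t) ->
        (\int[mu]_(t in [set: borel T]) (f t * w t)%:E < +oo)%E].

Variable w : T -> R.
Hypothesis hw : admissible_weight w.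

Lemma cc_weight_integrable (f : T -> R) : ccR f ->
  mu.-integrable [set: borel T] (fun t => (f t * w t)%:E).
Proof.
move=> cf; have [mw w0 wfin] := hw.
have mf (g : T -> R) : ccR g ->
    measurable_fun [set: borel T] (fun t : borel T => (g t * w t)%:E).
  move=> [cg _]; apply/measurable_EFinP; apply: measurable_funM => //.
  exact: continuous_borel_measurable.
apply/integrableP; split; first exact: mf.
have cn := @cc_norm R T R^o f cf.
under eq_integral => t _ do rewrite /= normrM (ger0_norm (w0 t)).
by apply: wfin => // t; exact: normr_ge0.
Qed.

Definition weighted_integral (f : T -> R) : R :=
  (\int[mu]_(t in [set: borel T]) (f t * w t)).

Lemma weighted_integralE (f : T -> R) : ccR f ->
  (weighted_integral f)%:E = (\int[mu]_(t in [set: borel T]) (f t * w t)%:E)%E.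
Proof. by move=> cf; rewrite fineK//; exact/integrable_fin_num/cc_weight_integrable. Qed.

Lemma weighted_integral_pfun : positive_functional weighted_integral.
Proof.
have [_ w0 _] := hw; split.
- move=> f g cf cg; rewrite /weighted_integral -RintegralD//; last 2 first.
  - exact: cc_weight_integrable cf.
  - exact: cc_weight_integrable cg.
  by apply: eq_Rintegral => t _; rewrite mulrDl.
- move=> a f cf; rewrite /weighted_integral -RintegralZl//; last first.
    exact: cc_weight_integrable cf.
  by apply: eq_Rintegral => t _; rewrite mulrA.
- by move=> f cf f0; apply: Rintegral_ge0 => t _; rewrite mulr_ge0.
Qed.

End BorelIntegration.

Section HaarIntegration.
Variables (R : realType) (G : topologicalGroupType).
Variable mu : {measure set (borel G) -> \bar R}.
Hypothesis hmu : left_haar_measure mu.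

Lemma mulg_continuous_l (s : G) : continuous (fun t : G => (s * t)%g).
Proof.
move=> t; apply: (@continuous_comp _ _ _ (fun t : G => (s, t)) (fun p => (p.1 * p.2)%g)).
  by apply: cvg_pair => /=; [exact: cvg_cst|exact: cvg_id].
exact: mulg_continuous.
Qed.

Lemma haar_integral_translate (f : G -> R) (s : G) :
  measurable_fun [set: borel G] (f : borel G -> R) -> (forall t, 0 <= f t) ->
  (\int[mu]_(t in [set: borel G]) (f (s * t)%g)%:E =
   \int[mu]_(t in [set: borel G]) (f t)%:E)%E.
Proof.
move=> mf f0; have mphi := continuous_borel_comp (@mulg_continuous_l s).
have := ge0_integral_pushforward mphi mu measurableT
  ((measurable_EFinP _ _).2 mf).
rewrite preimage_setT => <-; last by move=> t _; rewrite lee_fin.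
apply: (@eq_measure_integral _ _ _ _ mu) => B mB _.
rewrite -(haar_left_invariant hmu s^-1%g mB); congr (mu _).
apply/seteqP; split=> [t /= Bt|_ [t Bt <-]].
  by exists (s * t)%g => //; rewrite mulKg.
by rewrite /= mulVKg.
Qed.

Hypothesis hG : hausdorff_space G.

Definition haar (f : G -> R) : R := \int[mu]_(t in [set: borel G]) f t.

Lemma haar_admissible : admissible_weight mu (fun=> 1).
Proof.
split => //.
move=> f cf f0; under eq_integral do rewrite mulr1.
exact/integrable_lty/(cc_integral_fin hG (haar_compact hmu)).
Qed.

Lemma cc_haar_integrable (f : G -> R) : ccR f ->
  mu.-integrable [set: borel G] (fun t => (f t)%:E).
Proof. exact: cc_integral_fin (haar_compact hmu). Qed.

Lemma haarE (f : G -> R) : ccR f ->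
  (haar f)%:E = (\int[mu]_(t in [set: borel G]) (f t)%:E)%E.
Proof. by move=> cf; rewrite fineK//; exact/integrable_fin_num/cc_haar_integrable. Qed.

Lemma haar_pfun : positive_functional haar.
Proof.
have -> : haar = weighted_integral mu (fun=> 1).
  by apply/funext => f; apply: eq_Rintegral => t _; rewrite mulr1.
exact/weighted_integral_pfun/haar_admissible.
Qed.

Lemma cc_translate (V : normedModType R) (f : G -> V) (s : G) : cc f ->
  cc (fun t => f (s * t)%g).
Proof.
move=> [cf [K cK fK]]; split.
  by move=> t; apply: (continuous_comp (@mulg_continuous_l s t)); exact: cf.
exists ((fun t => s^-1 * t)%g @` K).
  by apply: continuous_compact => //; exact/continuous_subspaceT/mulg_continuous_l.
move=> t nt; apply: fK => Kst; apply: nt; exists (s * t)%g => //.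
by rewrite mulKg.
Qed.

(** Invariance holds for the integrals of nonnegative functions, so [f] is
    split into its positive and negative parts. *)
Lemma haar_translate (f : G -> R) (s : G) : ccR f ->
  haar (fun t => f (s * t)%g) = haar f.
Proof.
move=> cf; pose p t := Num.max (f t) 0; pose n t := Num.max (- f t) 0.
have cmax (g : R -> R) : continuous g -> g 0 = 0 ->
    ccR (fun t => Num.max (g (f t)) 0).
  move=> cg g0; apply: (@cc_comp R G R^o R^o f (fun x => Num.max (g x) 0) cf).
    by move=> x; apply: continuous_max; [exact: cg|exact: cvg_cst].
  by rewrite g0 maxxx.
have cp : ccR p by apply: (cmax id) => // x; exact: cvg_id.
have cn : ccR n by apply: (cmax -%R); [exact: opp_continuous|exact: oppr0].
have fE : f = (fun t => p t - n t).
  apply/funext => t; rewrite /p /n.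
  by case: (leP 0 (f t)) => ft; rewrite ?oppr_le0 ?oppr_ge0; case: leP; lra.
have tr (g : G -> R) : ccR g -> (forall t, 0 <= g t) ->
    haar (fun t => g (s * t)%g) = haar g.
  move=> cg g0; congr fine; apply: haar_integral_translate => //.
  by apply: continuous_borel_measurable; exact: cg.1.
have p0 t : 0 <= p t by rewrite /p le_max lexx orbT.
have n0 t : 0 <= n t by rewrite /n le_max lexx orbT.
have -> : (fun t => f (s * t)%g) = (fun t => p (s * t)%g - n (s * t)%g).
  by apply/funext => t; exact: (congr1 (fun h : G -> R => h (s * t)%g) fE).
rewrite (pfunB haar_pfun); last 2 first.
- exact: cc_translate cp.
- exact: cc_translate cn.
by rewrite !tr// [in RHS]fE (pfunB haar_pfun).
Qed.

End HaarIntegration.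

(** * Vector-valued integrals *)

Section WeakIntegral.
Variables (R : realType) (G : topologicalGroupType).
Variable mu : {measure set (borel G) -> \bar R}.
Hypothesis hmu : left_haar_measure mu.
Hypothesis lcG : locally_compact_group G.
Variable A : normedModType R.

Let hG : hausdorff_space G := lcG.1.

Lemma cc_functional (f : G -> A) (phi : {scalar A}) : cc f -> continuous phi ->
  ccR (fun t => phi (f t)).
Proof. by move=> cf cphi; apply: (@cc_comp R G A R^o f phi cf cphi); exact: raddf0. Qed.

Lemma vector_integral_haar (f : G -> A) (v : A) (phi : {scalar A}) :
  is_vector_integral mu f v -> continuous phi ->
  haar mu (fun t => phi (f t)) = phi v.
Proof. by move=> fv /fv[_ e]; rewrite /haar /Rintegral e. Qed.

(** A norming functional of [v] computes [`|v|] as an integral bounded by that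
    of the norm. *)
Lemma norm_vector_integral (f : G -> A) (v : A) : cc f ->
  is_vector_integral mu f v -> `|v| <= haar mu (fun t => `|f t|).
Proof.
move=> cf fv; have [phi [cphi phi1 <-]] := norming_functional v.
rewrite -(vector_integral_haar fv cphi); apply: (le_pfun (haar_pfun hmu hG)).
- exact: cc_functional.
- exact: cc_norm.
- by move=> t; rewrite (le_trans (ler_norm _)).
Qed.

(** By [cc_approx] there are points of [C], namely combinations of values of
    [f] with the integrals of the coefficients, at a small distance from [v],
    as norming functionals show; and [C] is closed. *)
Lemma vector_integral_cone (C : set A) (f : G -> A) (v : A) :
  is_cone C -> closed C -> cc f -> (forall t, C (f t)) ->
  is_vector_integral mu f v -> C v.
Proof.
move=> coneC clC cf Cf fv; have [u [cu u0 hu]] := cc_approx hG lcG.2 cf.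
rewrite (closure_id C).1//; apply/closure_normP => e e0.
have hp := haar_pfun hmu hG.
have Iu : 0 <= haar mu u by exact: (pfun_ge0 hp).
have c0 : 0 < haar mu u + 1 by rewrite ltr_wpDl.
pose d := e / (haar mu u + 1); have d0 : 0 < d by rewrite divr_gt0.
have [s [phi [cphi phi0 happ _ _]]] := hu d d0.
exists (\sum_(i <- s) haar mu (phi i) *: f i).
  apply: cone_sum => // i; have [_ _ CZ] := coneC.
  by apply: CZ => //; exact: (pfun_ge0 hp).
have [psi [cpsi psi1 <-]] :=
  norming_functional (v - \sum_(i <- s) haar mu (phi i) *: f i).
have psiB x y : psi (x - y) = psi x - psi y := raddfB psi x y.
have psi_comb (c : G -> R) :
    psi (\sum_(i <- s) c i *: f i) = \sum_(i <- s) psi (f i) * c i.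
  rewrite [LHS]raddf_sum; apply: eq_bigr => i _.
  by apply: etrans (scalarZ psi _ _) _; exact: mulrC.
have -> : psi (v - \sum_(i <- s) haar mu (phi i) *: f i) =
    haar mu (fun t => psi (f t)) - haar mu (fun t => \sum_(i <- s) psi (f i) * phi i t).
  rewrite (vector_integral_haar fv cpsi) (pfun_sum hp); last first.
    by move=> i; exact: ccRZ.
  rewrite psiB psi_comb; congr (_ - _).
  by apply: eq_bigr => i _; rewrite (pfunZ hp).
apply: le_lt_trans (ler_norm _) _.
apply: (@le_lt_trans _ _ (haar mu (fun t => d * u t))).
  apply: (pfun_dist hp).
  - exact: cc_functional.
  - by apply: (@cc_sum R G R^o) => i; exact: ccRZ.
  - exact: ccRZ.
  by move=> t; rewrite -(psi_comb (phi^~ t)) -psiB (le_trans (psi1 _)).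
by rewrite (pfunZ hp)// /d mulrAC ltr_pdivrMr// ltr_pM2l// ltrDl.
Qed.

End WeakIntegral.

(** * The module of compactly supported continuous functions *)

Section CcModule.
Variables (R : realType) (T : topologicalType) (A : normedModType R).
Implicit Types h k : Cc T A.

Lemma CcD h k t : (h + k) t = h t + k t.
Proof. exact: (congr1 (@^~ t) (raddfD (val : Cc T A -> (T -> A)) h k)). Qed.
Lemma CcB h k t : (h - k) t = h t - k t.
Proof. exact: (congr1 (@^~ t) (raddfB (val : Cc T A -> (T -> A)) h k)). Qed.
Lemma CcZ (a : R) h t : (a *: h) t = a *: h t.
Proof. exact: (congr1 (@^~ t) (linearZ_LR (val : Cc T A -> (T -> A)) a h)). Qed.
Lemma Cc0 t : (0 : Cc T A) t = 0.
Proof. exact: (congr1 (@^~ t) (raddf0 (val : Cc T A -> (T -> A)))). Qed.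
Lemma Cc_ext h k : h =1 k -> h = k.
Proof. by move=> hk; apply: val_inj; exact/funext. Qed.

Lemma is_cone_pointwise (C : set A) : is_cone C ->
  is_cone [set h : Cc T A | forall t, C (h t)].
Proof.
move=> coneC; have [_ CD CZ] := coneC; split.
- by exists 0 => t; rewrite Cc0; exact: cone0.
- by move=> h k Ch Ck t; rewrite CcD; exact: CD.
- by move=> a h a0 Ch t; rewrite CcZ; exact: CZ.
Qed.

End CcModule.

(** * The cone of the weighted space of integrable functions *)

Section WeightedL1.
Variables (R : realType) (A : completeNormedModType R).
Variables (G : topologicalGroupType) (mu : {measure set (borel G) -> \bar R}).
Variables (w : G -> R) (L : completeNormedModType R).
Variable iota : {linear Cc G A -> L}.
Variable C : set A.
Hypothesis lcG : locally_compact_group G.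
Hypothesis hw : weight w.
Hypothesis hL : is_L1 mu w iota.
Hypothesis coneC : is_cone C.
Hypothesis closedC : closed C.

Let hG : hausdorff_space G := lcG.1.
Let denseL := L1_dense hL.
Let w0 := weight_ge0 hw.

(** A zero of a submultiplicative function would propagate to the whole
    group. *)
Lemma weight_gt0 s : 0 < w s.
Proof.
rewrite lt0r w0 andbT; have [t wt] := weight_neq0 hw.
apply: contra_neq wt => ws0; apply/le_anti; rewrite w0 andbT.
by have := weight_submul hw s (s^-1 * t)%g; rewrite mulVKg ws0 mul0r.
Qed.

Lemma L1_normE h : (`|iota h|)%:E =
  (\int[mu]_(s in [set: borel G]) (`|h s| * w s)%:E)%E.
Proof. exact: (L1_isometry hL). Qed.

Lemma measurable_norm_weight (h : Cc G A) :
  measurable_fun [set: borel G] (fun s : borel G => (`|h s| * w s)%:E).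
Proof.
apply/measurable_EFinP; apply: measurable_funM; last exact: (weight_measurable hw).
by apply: continuous_borel_measurable; exact: (cc_norm (cc_of_Cc h)).1.
Qed.

Lemma L1_norm_mono (h k : Cc G A) : (forall s, `|h s| <= `|k s|) ->
  `|iota h| <= `|iota k|.
Proof.
move=> hk; rewrite -lee_fin !L1_normE; apply: ge0_le_integral => //.
- by move=> s _; rewrite lee_fin mulr_ge0.
- exact: measurable_norm_weight.
- exact: measurable_norm_weight.
- by move=> s _; rewrite lee_fin ler_wpM2r.
Qed.

(** Local integrability of the weight is contained in the finiteness of the
    norm of the functions [f t *: a]. *)
Lemma L1_admissible (a : A) : a != 0 -> admissible_weight mu w.
Proof.
move=> a0; split => //; first exact: (weight_measurable hw).
move=> f cf f0.
have [h hE] : exists h : Cc G A, h =1 (fun t => f t *: a).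
  by apply: (exists_Cc hG); apply: cc_scale => // t; exact: cvg_cst.
have na : 0 < `|a| by rewrite normr_gt0.
rewrite (_ : (\int[mu]_(s in _) _)%E = (`|iota ((`|a|)^-1 *: h)|)%:E) ?ltry//.
rewrite L1_normE; apply: eq_integral => s _; rewrite CcZ hE !normrZ normfV normr_id.
by rewrite (ger0_norm (f0 s)) mulrCA mulVf ?mulr1// gt_eqF.
Qed.

Lemma L1_trivial : (forall a : A, a = 0) -> forall v : L, v = 0.
Proof.
move=> A0 v; apply/eqP; rewrite -normr_le0; apply/ler_addgt0Pr => e e0.
have [h] := approx_dense denseL v e0.
have -> : h = 0 by apply: Cc_ext => t; rewrite Cc0.
by rewrite raddf0 subr0 add0r => /ltW.
Qed.

(** Nothing can be said about the weight when the algebra is zero; then,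
    however, the space of integrable functions is zero as well. *)
Lemma L1_trivial_or_admissible :
  (forall v : L, v = 0) \/ admissible_weight mu w.
Proof.
have [[a a0]|A0] := pselect (exists a : A, a != 0).
  by right; exact: L1_admissible a0.
left; apply: L1_trivial => a; apply/eqP; apply: contrapT => /negP a0.
by apply: A0; exists a.
Qed.

Lemma L1_norm_weighted (h : Cc G A) : admissible_weight mu w ->
  `|iota h| = weighted_integral mu w (fun s => `|h s|).
Proof.
move=> aw; apply: EFin_inj; rewrite L1_normE weighted_integralE//.
exact: cc_norm (cc_of_Cc h).
Qed.

Let Cpos := [set h : Cc G A | forall s, C (h s)].
Let K := L1_cone C iota.

Lemma is_cone_L1 : is_cone K.
Proof. exact/is_cone_closure/is_cone_image/is_cone_pointwise. Qed.

Lemma closed_L1 : closed K.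
Proof. exact: closed_closure. Qed.

(** A function [h] is close to a combination [sum_i phi_i h(i)]; splitting each
    value [h(i)] into a difference of positive vectors with norms at most [N *
    `|h i|] splits [h] up to a small error with control of the norms. *)
Lemma generating_L1 : generating_cone C -> generating_cone K.
Proof.
move=> genC.
have [N N0 hN] := almost_bounded_decomposition coneC genC.
have [L0 v|aw] := L1_trivial_or_admissible.
  exists 0, 0; split; [exact: (cone0 is_cone_L1)..|by rewrite subrr].
have hJ := weighted_integral_pfun aw; set J := weighted_integral mu w in hJ.
apply: (generating_of_approx is_cone_L1 closed_L1 N0) => v e e0.
(* The error in the norm bounds is at most [2 N d], that of the decomposition
   at most [3 d]: one [d] from density and two from the finite combinations. *)
pose d := e / (4 * (1 + N)).
have N1 : 0 < 1 + N by rewrite ltr_pwDl.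
have d0 : 0 < d by rewrite divr_gt0// mulr_gt0.
have dE : 4 * d + 4 * (N * d) = e by rewrite /d; field; rewrite gt_eqF.
have [h vh] := approx_dense denseL v d0.
have ch := cc_of_Cc h; have cn := cc_norm ch.
have [u [cu u0 hu]] := cc_approx hG lcG.2 ch.
have Ju : 0 <= J u by exact: (pfun_ge0 hJ).
have c0 : 0 < J u + 1 by rewrite ltr_wpDl.
pose q := d / (J u + 1); have q0 : 0 < q by rewrite divr_gt0.
have qJ : q * J u <= d by rewrite /q mulrAC ler_pdivrMr// ler_wpM2l ?(ltW d0)// lerDl.
have cqu : ccR (fun t => q * u t) by exact: ccRZ.
have [s [phi [cphi phi0 happ hsum phiu]]] := hu q q0.
have /choice[xy hxy] (i : G) : exists xy : A * A,
    [/\ C xy.1, C xy.2, `|xy.1| <= N * `|h i|, `|xy.2| <= N * `|h i| &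
        `|h i - (xy.1 - xy.2)| <= q].
  by have [x [y ?]] := hN (h i) q q0; exists (x, y).
have build (z : G -> A) : (forall i, C (z i)) ->
    (forall i, `|z i| <= N * `|h i|) -> exists k : Cc G A,
    [/\ Cpos k, (forall t, k t = \sum_(i <- s) phi i t *: z i) &
        `|iota k| <= N * `|v| + e].
  move=> Cz zN.
  have [k kE] : exists k : Cc G A, k =1 (fun t => \sum_(i <- s) phi i t *: z i).
    apply: (exists_Cc hG); apply: cc_sum => i; apply: cc_scale => // t.
    exact: cvg_cst.
  exists k; split => //.
    move=> t; rewrite kE; apply: cone_sum => // i.
    by have [_ _ CZ] := coneC; apply: CZ.
  apply: (@le_trans _ _ (N * (`|iota h| + q * J u))).
    rewrite !L1_norm_weighted// -/J -[q * _](pfunZ hJ)//.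
    rewrite -(pfunD hJ)//.
    have chu : ccR (fun t => `|h t| + q * u t) by exact: (@cc_add R G R^o).
    rewrite -(pfunZ hJ)//; apply: (le_pfun hJ); [exact: cc_norm (cc_of_Cc k)|exact: ccRZ|].
    move=> t; rewrite kE (le_trans (ler_norm_sum _ _ _))//.
    apply: (@le_trans _ _ (N * \sum_(i <- s) phi i t * `|h i|)).
      rewrite mulr_sumr; apply: ler_sum => i _.
      by rewrite normrZ ger0_norm// mulrCA ler_wpM2l.
    by rewrite ler_wpM2l.
  have hv : `|iota h| <= `|v| + d.
    by rewrite -lerBlDl (le_trans (lerB_dist _ _))// distrC ltW.
  have : N * (`|iota h| + q * J u) <= N * (`|v| + d + d).
    by rewrite ler_wpM2l// lerD.
  have := mulr_ge0 N0 (ltW d0); rewrite !mulrDr; lra.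
have [k [kpos kE kN]] : exists k : Cc G A,
    [/\ Cpos k, (forall t, k t = \sum_(i <- s) phi i t *: (xy i).1) &
        `|iota k| <= N * `|v| + e] by apply: build => i; have [] := hxy i.
have [l [lpos lE lN]] : exists k : Cc G A,
    [/\ Cpos k, (forall t, k t = \sum_(i <- s) phi i t *: (xy i).2) &
        `|iota k| <= N * `|v| + e] by apply: build => i; have [] := hxy i.
exists (iota k), (iota l); split => //; [exact: cone_iota..|].
have hkl : `|iota (h - (k - l))| <= d + d.
  apply: (@le_trans _ _ (q * J u + q * J u)); last exact: lerD.
  rewrite L1_norm_weighted// -/J -[q * _](pfunZ hJ)// -(pfunD hJ)//.
  apply: (le_pfun hJ); [exact: cc_norm (cc_of_Cc _)|exact: (@cc_add R G R^o)|].
  move=> t; rewrite !CcB kE lE -sumrB.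
  rewrite (le_trans (ler_distD (\sum_(i <- s) phi i t *: h i) _ _))// lerD//.
  rewrite -sumrB (le_trans (ler_norm_sum _ _ _))//.
  apply: (@le_trans _ _ (\sum_(i <- s) phi i t * q)).
    apply: ler_sum => i _; rewrite -!scalerBr normrZ ger0_norm// ler_wpM2l//.
    by have [] := hxy i.
  by rewrite -mulr_suml mulrC ler_wpM2l ?(ltW q0).
have -> : v - (iota k - iota l) = (v - iota h) + iota (h - (k - l)).
  by rewrite !raddfB [RHS]subrKA.
rewrite (le_trans (ler_normD _ _))//.
have := mulr_ge0 N0 (ltW d0); have := ltW vh; lra.
Qed.

(** If the right-hand side is infinite there is nothing to prove. Otherwise [h
    m] converges to some [a] in [C], and [k m] to [- a] because [h m + k m]
    tends to zero; as the cone is proper, [a = 0], and [h 0] is the sum of its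
    own increments. Covering the infinite case makes the inequality valid at
    every point of the group, without exceptional null sets. *)
Lemma cone_limit_zero (h k : nat -> A) (g : nat -> R) (wt : R) :
  proper_cone C -> 0 < wt -> (forall m, C (h m)) -> (forall m, C (k m)) ->
  (forall m, (`|h m.+1 - h m| + `|h m + k m|) * wt <= g m) ->
  ((`|h 0| * wt)%:E <= \sum_(m <oo) (g m)%:E)%E.
Proof.
move=> pC wt0 Ch Ck hg.
have g0 m : 0 <= g m.
  by apply: le_trans (hg m); rewrite mulr_ge0 ?addr_ge0// ltW.
have : (0 <= \sum_(m <oo) (g m)%:E)%E by apply: nneseries_ge0 => m _ _; rewrite lee_fin.
case E : (\sum_(m <oo) (g m)%:E)%E => [S| |] // S0; last by rewrite leey.
have partial n : series g n <= S.
  rewrite -lee_fin -E /series /= -sumEFin.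
  by apply: nneseries_lim_ge => m _ _; rewrite lee_fin.
have cg : cvgn (series g).
  apply: nondecreasing_is_cvgn.
    by apply: nondecreasing_series => m _ _.
  by exists S => _ [n _ <-].
have cgw : cvgn (series (fun m => wt^-1 * g m)).
  exact: (@is_cvg_seriesZ R g wt^-1 cg).
have dh m : `|h m.+1 - h m| <= wt^-1 * g m.
  by rewrite ler_pdivlMl// mulrC (le_trans _ (hg m))// ler_pM2r// lerDl.
have hk m : `|h m + k m| <= wt^-1 * g m.
  by rewrite ler_pdivlMl// mulrC (le_trans _ (hg m))// ler_pM2r// lerDr.
have gw0 m : 0 <= wt^-1 * g m by rewrite mulr_ge0// invr_ge0 ltW.
have cd : cvgn (series (telescope h)).
  by apply: normed_cvg; apply: (series_le_cvg _ gw0 dh cgw) => n; exact: normr_ge0.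
have ch : cvgn h.
  rewrite (_ : h = fun n => h 0 + series (telescope h) n).
    by apply: is_cvgD => //; exact: is_cvg_cst.
  by apply/funext => n; rewrite -eq_sum_telescope.
have hk0 : (fun m => h m + k m) @ \oo --> (0 : A).
  apply/cvgr0Pnorm_le => d d0.
  have /cvgr0Pnorm_le /(_ d d0) := cvg_series_cvg_0 cgw.
  by apply: filterS => m; rewrite ger0_norm//; exact: le_trans.
have Ca : C (limn h) by apply: (closed_cvg _ closedC _ _ ch); exact: nearW.
have CNa : C (- limn h).
  have kE : k = fun m => (h m + k m) - h m.
    by apply/funext => m; rewrite addrAC subrr add0r.
  have ck : k @ \oo --> - limn h by rewrite kE -[X in _ --> X]sub0r; exact: cvgB.
  by apply: (closed_cvg _ closedC _ _ ck); exact: nearW.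
have a0 : limn h = 0 by exact: pC.
rewrite lee_fin; apply/ler_addgt0Pl => d d0.
have dwt0 : 0 < d / wt by rewrite divr_gt0.
have /cvgr0Pnorm_le /(_ _ dwt0) [n _ /(_ n (leqnn n)) /= hn] :
  h @ \oo --> (0 : A) by rewrite -a0.
have h0n : h 0 = h n - series (telescope h) n.
  by rewrite [h n]eq_sum_telescope addrK.
have tel : `|series (telescope h) n| * wt <= series g n.
  apply: (@le_trans _ _ (series (fun m => `|telescope h m|) n * wt)).
    by rewrite ler_pM2r// ler_norm_sum.
  rewrite mulr_suml; apply: ler_sum => m _.
  by apply: le_trans (hg m); rewrite ler_pM2r// lerDl.
have hn' : `|h n| * wt <= d by rewrite -ler_pdivlMr.
apply: (@le_trans _ _ ((`|h n| + `|series (telescope h) n|) * wt)).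
  by rewrite ler_pM2r// h0n ler_normB.
by rewrite mulrDl lerD// (le_trans tel).
Qed.

(** If [v] and [- v] are limits of positive functions [h m] and [k m], then
    [cone_limit_zero], applied at each point and integrated term by term,
    bounds the norm of [h 0] by an arbitrarily small number. Pointwise limits
    are used because in a cone that is not normal a small sum [h m + k m] may
    have large terms. *)
Lemma proper_L1 : proper_cone C -> proper_cone K.
Proof.
move=> pC v Kv KNv; apply/eqP; rewrite -normr_le0.
apply/ler_addgt0Pr => e0' e0'0; rewrite add0r.
pose e := e0' / 2; have e0 : 0 < e by rewrite divr_gt0.
(* The errors [q m] sum to [e]; each is shared by the four approximations that
   bound the integral of [g m]. *)
pose q m : R := e / (2 ^ m.+1)%:R.
have q0 m : 0 < q m by rewrite divr_gt0// ltr0n expn_gt0.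
have q40 m : 0 < q m / 4 by rewrite divr_gt0.
have qS m : q m.+1 <= q m.
  rewrite /q ler_wpM2l ?(ltW e0)// lef_pV2 ?posrE ?ltr0n ?expn_gt0//.
  by rewrite ler_nat leq_exp2l.
have /choice[h hv] m : exists h, Cpos h /\ `|v - iota h| < q m / 4.
  by have [h ? ?] := (approx_coneP iota Cpos v).1 Kv _ (q40 m); exists h.
have /choice[k kv] m : exists k, Cpos k /\ `|- v - iota k| < q m / 4.
  by have [k ? ?] := (approx_coneP iota Cpos _).1 KNv _ (q40 m); exists k.
pose g m s := (`|h m.+1 s - h m s| + `|h m s + k m s|) * w s.
have intg m : (\int[mu]_(s in [set: borel G]) (g m s)%:E <= (q m)%:E)%E.
  under eq_integral => s _ do
    rewrite /g mulrDl -CcB -CcD EFinD.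
  rewrite ge0_integralD//; last 4 first.
  - by move=> s _; rewrite lee_fin mulr_ge0.
  - exact: measurable_norm_weight.
  - by move=> s _; rewrite lee_fin mulr_ge0.
  - exact: measurable_norm_weight.
  rewrite -!L1_normE -EFinD lee_fin.
  have := (hv m).2; have := (hv m.+1).2; have := (kv m).2; have := qS m.
  have -> : iota (h m.+1 - h m) = (v - iota (h m)) - (v - iota (h m.+1)).
    by rewrite raddfB [RHS]subrBB subrr sub0r opprB.
  have -> : iota (h m + k m) = - ((v - iota (h m)) + (- v - iota (k m))).
    by rewrite raddfD addrACA addrN add0r opprD !opprK.
  rewrite normrN.
  have := ler_normB (v - iota (h m)) (v - iota (h m.+1)).
  have := ler_normD (v - iota (h m)) (- v - iota (k m)).
  lra.
have mg m : measurable_fun [set: borel G] (fun s : borel G => (g m s)%:E).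
  apply/measurable_EFinP; apply: measurable_funM; last exact: (weight_measurable hw).
  have mn (f : Cc G A) : measurable_fun [set: borel G] (fun s : borel G => `|f s|).
    by apply: continuous_borel_measurable; exact: (cc_norm (cc_of_Cc f)).1.
  by under eq_fun do rewrite -CcB -CcD; exact: measurable_funD.
have g0 m s : 0 <= g m s by rewrite mulr_ge0 ?addr_ge0.
have h0 : `|iota (h 0)| <= e.
  rewrite -lee_fin L1_normE.
  apply: (@le_trans _ _ (\int[mu]_(s in [set: borel G]) \sum_(m <oo) (g m s)%:E)%E).
    apply: ge0_le_integral => //.
    - by move=> s _; rewrite lee_fin mulr_ge0.
    - exact: measurable_norm_weight.
    - apply: ge0_emeasurable_sum => [m s _ _|m _]; first by rewrite lee_fin.
      exact: mg.
    - move=> s _; apply: (@cone_limit_zero (fun m => h m s) (fun m => k m s)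
        (g^~ s) (w s) pC (weight_gt0 s)) => m.
      + exact: (hv m).1.
      + exact: (kv m).1.
      + exact: lexx.
  rewrite integral_nneseries//; last by move=> m s _; rewrite lee_fin.
  apply: (@le_trans _ _ (\sum_(m <oo) (q m)%:E)%E).
    by apply: lee_nneseries => m _ //; rewrite integral_ge0// => s _; rewrite lee_fin.
  exact/epsilon_trick0/ltW.
have vh : `|v| <= `|v - iota (h 0)| + `|iota (h 0)|.
  by rewrite -[in X in X <= _](subrK (iota (h 0)) v) ler_normD.
have qe : q 0 <= e.
  by rewrite /q ler_pdivrMr ?ltr0n// ler_peMr ?(ltW e0)// ler1n.
have := (hv 0).2; have : e + e = e0' by rewrite /e -splitr.
lra.
Qed.

End WeightedL1.

(** * Absolute values in Banach lattices *)

Section LatticeAbs.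
Variables (R : realType) (A : completeNormedModType R) (C : set A).
Hypothesis latC : banach_lattice C.

Let coneC : is_cone C. Proof. by case: latC => -[]. Qed.

Lemma exists_abs : exists J : A -> A, forall a, is_abs C a (J a).
Proof.
have [[_ _ lat] _] := latC.
have /choice[J JP] a : exists b, is_abs C a b by have [] := lat a (- a).
by exists J.
Qed.

Variable J : A -> A.
Hypothesis JP : forall a, is_abs C a (J a).

Lemma abs_ge a : C (J a - a). Proof. by have [] := JP a. Qed.

Lemma abs_geN a : C (J a + a).
Proof. by have [_ ] := JP a; rewrite /cone_le opprK. Qed.

Lemma abs_least a b : C (b - a) -> C (b + a) -> C (b - J a).
Proof. by have [_ _ h] := JP a => ba bna; apply: h => //; rewrite /cone_le opprK. Qed.

Lemma abs_ge0 a : C (J a).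
Proof.
have := cone_half coneC (abs_ge a) (abs_geN a).
by rewrite addrACA addNr addr0 half_double.
Qed.

Lemma is_abs_pos a : C a -> is_abs C a a.
Proof.
have [_ CD _] := coneC => Ca; split=> //; rewrite /cone_le.
  by rewrite subrr; exact: cone0.
by rewrite opprK; exact: CD.
Qed.

Lemma lattice_norm_mono a b : C a -> C (b - a) -> `|a| <= `|b|.
Proof.
have [_ CD _] := coneC; move=> Ca Cba; apply: (latC.2 _ _ a b) => //.
  exact: is_abs_pos.
by apply: is_abs_pos; rewrite -(subrK a b); exact: CD.
Qed.

Lemma norm_abs a : `|J a| = `|a|.
Proof.
have ref : cone_le C (J a) (J a) by rewrite /cone_le subrr; exact: cone0.
have JJ := is_abs_pos (abs_ge0 a).
by apply/le_anti; rewrite (latC.2 _ _ _ _ JJ (JP a) ref) (latC.2 _ _ _ _ (JP a) JJ ref).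
Qed.

(** By the triangle inequality in the lattice, [||a| - |b|| <= |a - b|], and
    the norm is monotone. *)
Lemma abs_lip a b : `|J a - J b| <= `|a - b|.
Proof.
apply: (latC.2 _ _ _ _ (JP _) (JP _)).
have [_ CD _] := coneC.
have tri x y : C (J y + J (x - y) - J x).
  apply: abs_least.
    rewrite (_ : _ - x = (J y - y) + (J (x - y) - (x - y))).
      by apply: CD; exact: abs_ge.
    by rewrite [RHS]addrACA -opprD (addrC y) subrK.
  rewrite (_ : _ + x = (J y + y) + (J (x - y) + (x - y))).
    by apply: CD; exact: abs_geN.
  by rewrite [RHS]addrACA (addrC y) subrK.
have JN x y : J (x - y) = J (y - x).
  have [_ pC _] := latC.1; apply/eqP; rewrite -subr_eq0; apply/eqP.
  have sym u v : C (J (u - v) - J (v - u)).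
    apply: abs_least.
      by rewrite -[v - u]opprB opprK; exact: abs_geN.
    by rewrite -[v - u]opprB; exact: abs_ge.
  by apply: pC; [exact: sym|rewrite opprB; exact: sym].
apply: abs_least.
  by rewrite opprB addrA [J (a - b) + _]addrC; exact: tri.
by rewrite addrA JN [J (b - a) + _]addrC; exact: tri.
Qed.

Lemma continuous_abs : continuous J.
Proof.
move=> a; apply/cvgrPdist_lt => e e0; near=> b.
apply: (le_lt_trans (abs_lip a b)); near: b.
by apply: (@cvgr_dist_lt _ _ _ _ _ id) => //; exact: cvg_id.
Unshelve. all: by end_near. Qed.

Lemma abs0 : J 0 = 0.
Proof. by apply/eqP; rewrite -normr_eq0 norm_abs normr0. Qed.

End LatticeAbs.

Section LatticeL1.
Variables (R : realType) (A : completeNormedModType R).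
Variables (G : topologicalGroupType) (mu : {measure set (borel G) -> \bar R}).
Variables (w : G -> R) (L : completeNormedModType R).
Variable iota : {linear Cc G A -> L}.
Variable C : set A.
Hypothesis lcG : locally_compact_group G.
Hypothesis hw : weight w.
Hypothesis hL : is_L1 mu w iota.
Hypothesis closedC : closed C.

(** The absolute value of a compactly supported function is formed pointwise;
    it is continuous because the absolute value of a Banach lattice is
    non-expansive. *)
Lemma banach_lattice_L1 : banach_lattice C -> banach_lattice (L1_cone C iota).
Proof.
move=> latC; have [[coneC pC _] _] := latC.
have [J JP] := exists_abs latC.
have /choice[JJ JJE] (h : Cc G A) : exists k : Cc G A, k =1 J \o h.
  apply: (exists_Cc lcG.1); apply: cc_comp (cc_of_Cc h) _ _.
    exact: (continuous_abs latC JP).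
  exact: (abs0 latC JP).
apply: (@banach_lattice_completion _ _ _ iota
  [set h : Cc G A | forall s, C (h s)] JJ).
- exact: L1_dense hL.
- exact: is_cone_pointwise.
- by move=> h s; rewrite CcB JJE; exact: (abs_ge JP).
- by move=> h s; rewrite CcD JJE; exact: (abs_geN JP).
- move=> h k kh kh' s; rewrite CcB JJE; apply: (abs_least JP).
    by rewrite -CcB; exact: kh.
  by rewrite -CcD; exact: kh'.
- move=> h; apply/le_anti/andP; split; apply: (L1_norm_mono hw hL) => s;
    by rewrite JJE /= (norm_abs latC JP).
- move=> h k; apply: (L1_norm_mono hw hL) => s.
  by rewrite !CcB !JJE; exact: (abs_lip latC JP).
- move=> h k Ch Ckh; apply: (L1_norm_mono hw hL) => s.
  by apply: (lattice_norm_mono latC (Ch s)); rewrite -CcB; exact: Ckh.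
- exact: (proper_L1 hw hL closedC pC).
Qed.

End LatticeL1.

(** * The product of the Beurling algebra *)

Lemma linear_fun0 (R : realType) (U V : lmodType R) (f : U -> V) :
  linear f -> f 0 = 0.
Proof.
by move=> lf; have := lf (-1) 0 0; rewrite scaler0 addr0 scaleN1r addNr.
Qed.

Lemma linear_funB (R : realType) (U V : lmodType R) (f : U -> V) x y :
  linear f -> f (x - y) = f x - f y.
Proof. by move=> lf; rewrite addrC -scaleN1r lf scaleN1r addrC. Qed.

Lemma closure_sub_preimage (X Y : topologicalType) (f : X -> Y) (D : set Y)
  (S : set X) : continuous f -> closed D -> S `<=` f @^-1` D ->
  closure S `<=` f @^-1` D.
Proof.
move=> cf cD SD; have cP : closed (f @^-1` D) by apply: closed_comp => // x _; exact: cf.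
by rewrite [X in _ `<=` X](closure_id _).1//; exact: closureS.
Qed.

Section BeurlingProduct.
Variables (R : realType) (A : completeNormedModType R) (mul : A -> A -> A).
Variables (Apos : set A) (G : topologicalGroupType) (alpha : G -> A -> A).
Variables (mu : {measure set (borel G) -> \bar R}) (w : G -> R).
Variables (L : completeNormedModType R) (iota : {linear Cc G A -> L}).
Variable mulL : L -> L -> L.
Hypothesis hsys : preordered_dynamical_system mul Apos alpha.
Hypothesis hbdd : uniformly_bounded alpha.
Hypothesis hmu : left_haar_measure mu.
Hypothesis hw : weight w.
Hypothesis hL : is_L1 mu w iota.
Hypothesis hmulL : is_beurling_mul mul alpha mu iota mulL.

Let lcG := pds_group hsys.
Let hG : hausdorff_space G := lcG.1.
Let algA : banach_algebra mul. Proof. by case: (pds_algebra hsys). Qed.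
Let mul_bilin : bilinear_mul mul. Proof. by case: algA. Qed.
Let mul_linr x : linear (mul x) := mul_bilin.1 x.
Let mul_linl y : linear (mul^~ y) := mul_bilin.2 y.
Let mul_norm x y : `|mul x y| <= `|x| * `|y|. Proof. by case: algA. Qed.
Let alpha_lin s : linear (alpha s). Proof. by case: (pds_aut hsys s). Qed.
Let hI := haar_pfun hmu hG.

Lemma mul_continuous : continuous (fun p : A * A => mul p.1 p.2).
Proof.
move=> [x0 y0]; apply/cvgrPdist_lt => e e0.
pose M := (`|y0| + 1) + `|x0|.
have y10 : 0 < `|y0| + 1 by rewrite ltr_wpDl.
have M0 : 0 < M by rewrite ltr_wpDr.
pose d := Num.min 1 (e / M); have d0 : 0 < d by rewrite lt_min ltr01 divr_gt0.
have nx : nbhs x0 [set x | `|x0 - x| < d].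
  by have /cvgrPdist_lt /(_ d d0) := @cvg_id _ (nbhs x0).
have ny : nbhs y0 [set y | `|y0 - y| < d].
  by have /cvgrPdist_lt /(_ d d0) := @cvg_id _ (nbhs y0).
exists ([set x | `|x0 - x| < d], [set y | `|y0 - y| < d]) => // -[x y] [/= xd yd].
have -> : mul x0 y0 - mul x y = mul (x0 - x) y + mul x0 (y0 - y).
  by rewrite (linear_funB _ _ (mul_linr x0)) (linear_funB _ _ (mul_linl y)) [RHS]addrC subrKA.
have y1 : `|y| <= `|y0| + 1.
  rewrite -lerBlDl (le_trans (lerB_dist _ _))// distrC ltW//.
  by rewrite (lt_le_trans yd)// ge_min lexx.
apply: (le_lt_trans (ler_normD _ _)).
apply: (@le_lt_trans _ _ (`|x0 - x| * (`|y0| + 1) + `|x0| * `|y0 - y|)).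
  by rewrite lerD// (le_trans (mul_norm _ _))// ler_wpM2l.
apply: (@lt_le_trans _ _ (d * M)); last first.
  by rewrite -ler_pdivlMr// ge_min lexx orbT.
rewrite /M [d * _]mulrDr ltr_leD//; first by rewrite ltr_pM2r.
by rewrite [d * _]mulrC ler_wpM2l// ltW.
Qed.

(** Uniform boundedness upgrades strong continuity to joint continuity. *)
Lemma alpha_continuous : continuous (fun p : G * A => alpha p.1 p.2).
Proof.
move=> [r0 x0]; apply/cvgrPdist_lt => e e0; have [M0 hM0] := hbdd.
pose M := `|M0| + 1; have M1 : 0 < M by rewrite ltr_wpDl.
have hM s a : `|alpha s a| <= M * `|a|.
  rewrite (le_trans (hM0 s a))// ler_wpM2r// (le_trans (ler_norm _))//.
  by rewrite lerDl.
have e20 : 0 < e / 2 by rewrite divr_gt0.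
have d0 : 0 < e / 2 / M by rewrite divr_gt0.
have nx : nbhs x0 [set x | `|x0 - x| < e / 2 / M].
  by have /cvgrPdist_lt /(_ _ d0) := @cvg_id _ (nbhs x0).
have nr : nbhs r0 [set r | `|alpha r0 x0 - alpha r x0| < e / 2].
  by have /cvgrPdist_lt /(_ _ e20) := @pds_strongly_continuous _ _ _ _ _ _ hsys x0 r0.
exists ([set r | `|alpha r0 x0 - alpha r x0| < e / 2],
        [set x | `|x0 - x| < e / 2 / M]) => // -[r x] [/= hr hx].
apply: (le_lt_trans (ler_distD (alpha r x0) _ _)).
rewrite (splitr e) ltrD// -(linear_funB _ _ (alpha_lin r)).
by rewrite (le_lt_trans (hM _ _))// mulrC -ltr_pdivlMr.
Qed.

Section Composites.
Variable X : topologicalType.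

Lemma continuous_mul (a b : X -> A) : continuous a -> continuous b ->
  continuous (fun x => mul (a x) (b x)).
Proof.
move=> ca cb x; apply: (@continuous_comp _ _ _ (fun x => (a x, b x)) (fun p => mul p.1 p.2)).
  by apply: cvg_pair => /=; [exact: ca|exact: cb].
exact: mul_continuous.
Qed.

Lemma continuous_alpha (r : X -> G) (a : X -> A) : continuous r ->
  continuous a -> continuous (fun x => alpha (r x) (a x)).
Proof.
move=> cr ca x; apply: (@continuous_comp _ _ _ (fun x => (r x, a x)) (fun p => alpha p.1 p.2)).
  by apply: cvg_pair => /=; [exact: cr|exact: ca].
exact: alpha_continuous.
Qed.

Lemma continuous_ldiv (r s : X -> G) : continuous r -> continuous s ->
  continuous (fun x => (r x)^-1 * s x)%g.
Proof.
move=> cr cs x.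
apply: (@continuous_comp _ _ _ (fun x => ((r x)^-1%g, s x)) (fun p => (p.1 * p.2)%g)).
  apply: cvg_pair => /=; last exact: cs.
  by apply: continuous_comp; [exact: cr|exact: invg_continuous].
exact: mulg_continuous.
Qed.

Lemma continuous_Cc (f : Cc G A) (r : X -> G) : continuous r ->
  continuous (fun x => f (r x)).
Proof.
by move=> cr x; apply: continuous_comp; [exact: cr|exact: (cc_of_Cc f).1].
Qed.

End Composites.

Lemma cc_twisted (f g : Cc G A) (s : G) :
  cc (fun r => mul (f r) (alpha r (g (r^-1 * s)%g))).
Proof.
have [cf [K cK fK]] := cc_of_Cc f; split; last first.
  by exists K => // r nKr; rewrite fK// (linear_fun0 (mul_linl _)).
apply: continuous_mul; first exact: cf.
apply: continuous_alpha; first by move=> x; exact: cvg_id.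
apply: continuous_Cc; apply: continuous_ldiv; first by move=> x; exact: cvg_id.
by move=> x; exact: cvg_cst.
Qed.

Lemma compact_mulg (K K' : set G) : compact K -> compact K' ->
  compact [set (p.1 * p.2)%g | p in K `*` K'].
Proof.
move=> cK cK'; apply: continuous_compact; last exact: compact_setX.
by apply: continuous_subspaceT; exact: mulg_continuous.
Qed.

(** Continuous linear maps commute with the vector-valued integral, because the
    composite of such a map with a functional is a functional. *)
Lemma vector_integral_comp (f : G -> A) (v : A) (phi : {scalar A}) (T : A -> A) :
  linear T -> continuous T -> continuous phi -> is_vector_integral mu f v ->
  haar mu (fun t => phi (T (f t))) = phi (T v).
Proof.
move=> lT cT cphi fv.
have plin : linear ((phi \o T) : A -> R^o).
  move=> a x y /=; rewrite lT; apply: etrans (raddfD phi _ _) _.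
  by congr (_ + _); exact: (scalarZ phi).
pose psi : {scalar A} := HB.pack (phi \o T) (GRing.isLinear.Build R A R^o *%R (phi \o T) plin).
apply: (@vector_integral_haar _ _ _ _ f v psi fv).
by move=> x; apply: continuous_comp; [exact: cT|exact: cphi].
Qed.

Lemma mulL_conv (f g : Cc G A) : exists h : Cc G A,
  is_twisted_convolution mul alpha mu f g h /\ mulL (iota f) (iota g) = iota h.
Proof. by have [h ? ?] := beurling_extends hmulL f g; exists h. Qed.

Lemma mulL_continuous_l y : continuous (mulL^~ y).
Proof.
move=> x; apply: (@continuous_comp _ _ _ (fun x => (x, y)) (fun p => mulL p.1 p.2)).
  by apply: cvg_pair => /=; [exact: cvg_id|exact: cvg_cst].
exact: (beurling_continuous hmulL).
Qed.

Lemma mulL_continuous_r x : continuous (mulL x).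
Proof.
move=> y; apply: (@continuous_comp _ _ _ (fun y => (x, y)) (fun p => mulL p.1 p.2)).
  by apply: cvg_pair => /=; [exact: cvg_cst|exact: cvg_id].
exact: (beurling_continuous hmulL).
Qed.

Let coneA : is_cone Apos. Proof. by case: (pds_algebra hsys). Qed.
Let Apos_mul x y : Apos x -> Apos y -> Apos (mul x y).
Proof. by case: (pds_algebra hsys) => _ _; exact. Qed.

(** The product is continuous and the cone is closed, so only products of
    functions matter, and these are integrals of positive functions. *)
Lemma L1_cone_mul x y : L1_cone Apos iota x -> L1_cone Apos iota y ->
  L1_cone Apos iota (mulL x y).
Proof.
have clK : closed (L1_cone Apos iota) by exact: closed_closure.
move=> Kx; move: y.
apply: (closure_sub_preimage (@mulL_continuous_r x) clK) => _ [g gpos <-] /=.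
move: x Kx.
apply: (closure_sub_preimage (@mulL_continuous_l (iota g)) clK) => _ [f fpos <-] /=.
have [h [fgh ->]] := mulL_conv f g.
apply: subset_closure; exists h => // s /=.
apply: (vector_integral_cone hmu lcG coneA (pds_closed hsys) (cc_twisted f g s) _ (fgh s)).
move=> r; apply: Apos_mul => //.
by have [_ _ _ [b [_ _ _ + _]]] := pds_aut hsys r; apply.
Qed.

Lemma dense_ind (P : set L) : closed P -> (forall f, P (iota f)) -> forall x, P x.
Proof.
move=> cP Pf x; rewrite ((closure_id P).1 cP); apply/closure_normP => e e0.
by have [h xh] := approx_dense (L1_dense hL) x e0; exists (iota h).
Qed.

(** After applying a functional, both products are iterated integrals of the
    same kernel [F]: the left translation [u = r^-1 t] of the Haar measure, the
    multiplicativity of the action and [alpha_r alpha_(r^-1 t) = alpha_t] bring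
    the first one to this form, and the order of integration is exchanged. *)
Lemma twisted_convolution_assoc (f g h fg gh k1 k2 : Cc G A) :
  is_twisted_convolution mul alpha mu f g fg ->
  is_twisted_convolution mul alpha mu g h gh ->
  is_twisted_convolution mul alpha mu f gh k1 ->
  is_twisted_convolution mul alpha mu fg h k2 -> k1 = k2.
Proof.
move=> hfg hgh hk1 hk2; apply: Cc_ext => s.
have [phi [cphi _ phiE]] := norming_functional (k1 s - k2 s).
suff e : phi (k1 s) = phi (k2 s).
  apply/eqP; rewrite -subr_eq0 -normr_eq0 -phiE.
  have -> : phi (k1 s - k2 s) = phi (k1 s) - phi (k2 s) := raddfB phi _ _.
  by rewrite e subrr.
pose F r t := phi (mul (mul (f r) (alpha r (g (r^-1 * t)%g)))
                       (alpha t (h (t^-1 * s)%g))).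
have [_ mulA _] := algA.
have e1 : phi (k1 s) = haar mu (fun r => haar mu (F r)).
  rewrite -(vector_integral_haar (hk1 s) cphi); congr haar; apply/funext => r.
  pose T a := mul (f r) (alpha r a).
  have lT : linear T by move=> a x y; rewrite /T alpha_lin mul_linr.
  have cT : continuous T.
    apply: continuous_mul; first by move=> x; exact: cvg_cst.
    by apply: continuous_alpha => x; [exact: cvg_cst|exact: cvg_id].
  rewrite -/(T (gh (r^-1 * s)%g)) -(vector_integral_comp lT cT cphi (hgh _)).
  rewrite -(haar_translate hmu hG r^-1%g); last first.
    apply: cc_functional cphi; apply: cc_comp (cc_twisted _ _ _) cT _.
    exact: linear_fun0.
  congr haar; apply/funext => t; rewrite /F /T; congr (phi _).
  have [_ am _ _] := pds_aut hsys r.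
  rewrite am mulA -(pds_morph hsys) mulVKg.
  by congr (mul _ (alpha _ (h _))); rewrite invgM invgK mulgA mulgK.
have e2 : phi (k2 s) = haar mu (fun t => haar mu (F^~ t)).
  rewrite -(vector_integral_haar (hk2 s) cphi); congr haar; apply/funext => t.
  rewrite -(vector_integral_comp (T := mul^~ (alpha t (h (t^-1 * s)%g))) _ _ cphi (hfg t))//.
  apply: continuous_mul; last by move=> x; exact: cvg_cst.
  by move=> x; exact: cvg_id.
have [_ [Kf cKf fK]] := cc_of_Cc f; have [_ [Kg cKg gK]] := cc_of_Cc g.
have F0 r t : f r = 0 \/ g (r^-1 * t)%g = 0 -> F r t = 0.
  rewrite /F; move=> fg0.
  have -> : mul (f r) (alpha r (g (r^-1 * t)%g)) = 0.
    case: fg0 => ->; first exact: (linear_fun0 (mul_linl _)).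
    by rewrite (linear_fun0 (alpha_lin r)) (linear_fun0 (mul_linr _)).
  by rewrite (linear_fun0 (mul_linl _)); exact: raddf0.
rewrite e1 e2; apply: (pfun_fubini hG lcG.2 hI hI (K1 := Kf)
  (K2 := [set (p.1 * p.2)%g | p in Kf `*` Kg]) _ cKf (compact_mulg cKf cKg)).
- move=> p; apply: (@continuous_comp _ _ _ (fun p : G * G =>
    mul (mul (f p.1) (alpha p.1 (g (p.1^-1 * p.2)%g))) (alpha p.2 (h (p.2^-1 * s)%g)))
    phi); last exact: cphi.
  have c1 : continuous (fun p : G * G => p.1) by move=> q; exact: cvg_fst.
  have c2 : continuous (fun p : G * G => p.2) by move=> q; exact: cvg_snd.
  apply: continuous_mul; [apply: continuous_mul|]; [|apply: continuous_alpha => //..].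
  + exact: continuous_Cc.
  + by apply: continuous_Cc; exact: continuous_ldiv.
  + apply: continuous_Cc; apply: continuous_ldiv => //.
    by move=> x; exact: cvg_cst.
- by move=> r t nK; apply: F0; left; exact: fK.
- move=> r t nK; apply: F0.
  have [Kr|nKr] := pselect (Kf r); last by left; exact: fK.
  right; apply: gK => Krt; apply: nK; exists (r, r^-1 * t)%g => //=.
  by rewrite mulVKg.
Qed.

Lemma mulL_assoc : associative mulL.
Proof.
have ceq (p q : L -> L) : continuous p -> continuous q ->
    (forall f, p (iota f) = q (iota f)) -> p =1 q.
  move=> cp cq pq.
  have c0 : closed [set x | p x - q x = 0].
    apply: (@closed_comp _ _ (fun x => p x - q x) [set 0]).
      by move=> x _; apply: cvgB; [exact: cp|exact: cq].
    by apply: accessible_closed_set1; exact/hausdorff_accessible/norm_hausdorff.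
  move=> x; apply/eqP; rewrite -subr_eq0; apply/eqP.
  by apply: (dense_ind c0) => f /=; rewrite pq subrr.
have cl := mulL_continuous_l; have cr := mulL_continuous_r.
have comp (p q : L -> L) : continuous p -> continuous q -> continuous (p \o q).
  by move=> cp cq x; apply: continuous_comp; [exact: cq|exact: cp].
move=> x y z; move: x; apply: (ceq) => [||f].
- exact: cl.
- exact: (comp (mulL^~ z) (mulL^~ y)).
move: y; apply: (ceq) => [||g].
- exact: (comp (mulL (iota f)) (mulL^~ z)).
- exact: (comp (mulL^~ z) (mulL (iota f))).
move: z; apply: (ceq) => [||h].
- exact: (comp (mulL (iota f)) (mulL (iota g))).
- exact: cr.
have [gh [hgh ->]] := mulL_conv g h; have [k1 [hk1 ->]] := mulL_conv f gh.
have [fg [hfg ->]] := mulL_conv f g; have [k2 [hk2 ->]] := mulL_conv fg h.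
by congr (iota _); exact: (twisted_convolution_assoc hfg hgh hk1 hk2).
Qed.

Hypothesis alpha_isometry : forall s a, `|alpha s a| = `|a|.

(** With an isometric action, the norm of the product at [s] is at most the
    convolution of the scalar functions [`|f|] and [`|g|] at [s]. Exchanging
    the two integrations, translating by [r] and using [w (r t) <= w r * w t]
    gives the product of the norms. *)
Lemma twisted_convolution_norm (f g h : Cc G A) : admissible_weight mu w ->
  is_twisted_convolution mul alpha mu f g h ->
  `|iota h| <= `|iota f| * `|iota g|.
Proof.
move=> aw fgh; have hJ := weighted_integral_pfun aw.
set J := weighted_integral mu w in hJ.
have [cf [Kf cKf fK]] := cc_of_Cc f; have [cg [Kg cKg gK]] := cc_of_Cc g.
pose F r s := `|f r| * `|g (r^-1 * s)%g|.
have cF : continuous (fun p : G * G => F p.1 p.2).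
  have c1 : continuous (fun p : G * G => p.1) by move=> q; exact: cvg_fst.
  have c2 : continuous (fun p : G * G => p.2) by move=> q; exact: cvg_snd.
  move=> p; apply: cvgM; apply: cvg_norm.
    exact: (continuous_Cc (f := f) c1).
  exact: (continuous_Cc (f := g) (continuous_ldiv c1 c2)).
pose K2 := [set (p.1 * p.2)%g | p in Kf `*` Kg].
have cK2 : compact K2 := compact_mulg cKf cKg.
have FK1 r s : ~ Kf r -> F r s = 0.
  by move=> nK; rewrite /F fK// normr0 mul0r.
have FK2 r s : ~ K2 s -> F r s = 0.
  move=> nK; have [Kr|nKr] := pselect (Kf r); last exact: FK1.
  rewrite /F gK ?normr0 ?mulr0// => Krs; apply: nK; exists (r, r^-1 * s)%g => //=.
  by rewrite mulVKg.
have cFr s : ccR (F^~ s).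
  split; last by exists Kf => // r; exact: FK1.
  move=> r; apply: (@continuous_comp _ _ _ (fun r => (r, s)) (fun p => F p.1 p.2)).
    by apply: cvg_pair => /=; [exact: cvg_id|exact: cvg_cst].
  exact: cF.
have cF' : continuous (fun p : G * G => F p.2 p.1).
  move=> p; apply: (@continuous_comp _ _ _ (fun p : G * G => (p.2, p.1)) (fun p => F p.1 p.2)).
    by apply: cvg_pair => /=; [exact: cvg_snd|exact: cvg_fst].
  exact: cF.
have hle s : `|h s| <= haar mu (F^~ s).
  apply: (le_trans (norm_vector_integral hmu lcG (cc_twisted f g s) (fgh s))).
  apply: (le_pfun hI) => //; first exact: cc_norm (cc_twisted f g s).
  by move=> r; rewrite (le_trans (mul_norm _ _))// alpha_isometry.
have step1 : `|iota h| <= haar mu (fun r => J (F r)).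
  rewrite (L1_norm_weighted hL h aw) -/J (pfun_fubini hG lcG.2 hI hJ cF cKf cK2 FK1 FK2).
  apply: (le_pfun hJ) => //; first exact: cc_norm (cc_of_Cc h).
  apply: (cc_pfun_kernel (F := fun s r => F r s) hG lcG.2 hI cF' cK2 cKf).
    by move=> s r nK; exact: FK2.
  by move=> s r nK; exact: FK1.
apply: (le_trans step1).
have translate r : J (fun s => `|g (r^-1 * s)%g|) <= w r * `|iota g|.
  have cgr : ccR (fun s => `|g (r^-1 * s)%g|).
    exact: (cc_norm (cc_translate _ (cc_of_Cc g))).
  rewrite -lee_fin /J weighted_integralE//.
  (* The integrand is the left translate of [p] by [r^-1]. *)
  pose p t := `|g t| * w (r * t)%g.
  have mw : measurable_fun [set: borel G] (fun t : borel G => w (r * t)%g).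
    apply: (@measurableT_comp _ _ _ _ _ _ (w : borel G -> R)).
      exact: (weight_measurable hw).
    exact: (continuous_borel_comp (@mulg_continuous_l G r)).
  have mp : measurable_fun [set: borel G] (p : borel G -> R).
    apply: measurable_funM => //.
    by apply: continuous_borel_measurable; exact: (cc_norm (cc_of_Cc g)).1.
  have p0 t : 0 <= p t by rewrite mulr_ge0// (weight_ge0 hw).
  rewrite (_ : (\int[mu]_(t in _) _)%E =
      (\int[mu]_(t in [set: borel G]) (p (r^-1 * t)%g)%:E)%E); last first.
    by apply: eq_integral => t _; rewrite /p mulVKg.
  rewrite (haar_integral_translate hmu r^-1%g mp p0) EFinM (L1_normE hL).
  rewrite -ge0_integralZl//; last 3 first.
  - exact: measurable_norm_weight.
  - by move=> t _; rewrite lee_fin mulr_ge0// (weight_ge0 hw).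
  - by rewrite lee_fin (weight_ge0 hw).
  apply: ge0_le_integral => //.
  - by move=> t _; rewrite lee_fin.
  - exact/measurable_EFinP.
  - by apply: measurable_funeM; exact: measurable_norm_weight.
  - move=> t _; rewrite -EFinM lee_fin /p mulrCA ler_wpM2l//.
    exact: (weight_submul hw).
have cJF : ccR (fun r => J (F r)) by exact: (cc_pfun_kernel hG lcG.2 hJ cF cKf cK2 FK1 FK2).
rewrite -lee_fin (haarE hmu hG cJF) mulrC EFinM (L1_normE hL f).
rewrite -ge0_integralZl//; last 2 first.
- exact: measurable_norm_weight.
- by move=> t _; rewrite lee_fin mulr_ge0// (weight_ge0 hw).
have JF r : J (F r) = `|f r| * J (fun s => `|g (r^-1 * s)%g|).
  by rewrite -(pfunZ hJ)//; exact: (cc_norm (cc_translate _ (cc_of_Cc g))).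
apply: ge0_le_integral => //.
- move=> r _; rewrite lee_fin; apply: (pfun_ge0 hJ).
    exact: (cc_kernel cF cK2 FK2).
  by move=> s; rewrite mulr_ge0.
- by apply/measurable_EFinP; apply: continuous_borel_measurable; exact: cJF.1.
- by apply: measurable_funeM; exact: measurable_norm_weight.
- move=> r _; rewrite -EFinM lee_fin JF mulrCA ler_wpM2l//.
  by rewrite mulrC.
Qed.

Lemma mulL_norm x y : `|mulL x y| <= `|x| * `|y|.
Proof.
have [L0|aw] := L1_trivial_or_admissible lcG hw hL.
  by rewrite (L0 (mulL x y)) normr0 mulr_ge0.
have cle (p q : L -> R) : continuous p -> continuous q ->
    (forall f, p (iota f) <= q (iota f)) -> forall x, p x <= q x.
  move=> cp cq pq.
  have c0 : closed [set x | 0 <= q x - p x].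
    apply: (@closed_comp _ _ (fun x => q x - p x) [set r | 0 <= r]).
      by move=> z _; apply: cvgB; [exact: cq|exact: cp].
    exact: closed_ge.
  by move=> z; rewrite -subr_ge0; apply: (dense_ind c0) => f /=; rewrite subr_ge0.
have cn (p : L -> L) : continuous p -> continuous (fun z => `|p z|).
  by move=> cp z; apply: cvg_norm; exact: cp.
move: x; apply: (cle) => [||f].
- exact/cn/mulL_continuous_l.
- by move=> z; apply: cvgM; [apply: cvg_norm; exact: cvg_id|exact: cvg_cst].
move: y; apply: (cle) => [||g].
- exact/cn/mulL_continuous_r.
- by move=> z; apply: cvgM; [exact: cvg_cst|apply: cvg_norm; exact: cvg_id].
have [h [fgh ->]] := mulL_conv f g.
exact: twisted_convolution_norm.
Qed.

End BeurlingProduct.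

Theorem theorem5p8 (R : realType) (A : completeNormedModType R)
    (mul : A -> A -> A) (Apos : set A)
    (G : topologicalGroupType) (alpha : G -> A -> A)
    (mu : {measure set (borel G) -> \bar R}) (w : G -> R)
    (L : completeNormedModType R) (iota : {linear Cc G A -> L})
    (mulL : L -> L -> L)
    (hsys : preordered_dynamical_system mul Apos alpha)
    (happrox : has_bounded_approx_right_identity mul)
    (hbdd : uniformly_bounded alpha)
    (hmu : left_haar_measure mu)
    (hw : weight w)
    (hL : is_L1 mu w iota)
    (hmulL : is_beurling_mul mul alpha mu iota mulL) :
  [/\ generating_cone Apos -> generating_cone (L1_cone Apos iota),
      proper_cone Apos -> proper_cone (L1_cone Apos iota),
      banach_lattice_algebra mul Apos -> banach_lattice (L1_cone Apos iota) &
      banach_lattice_algebra mul Apos ->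
      (forall s, bipositive Apos Apos (alpha s) /\
                 forall a, `|alpha s a| = `|a|) ->
      banach_lattice_algebra mulL (L1_cone Apos iota)].
Proof.
have coneA : is_cone Apos by case: (pds_algebra hsys).
have lcG := pds_group hsys; have clA := pds_closed hsys.
split.
- exact: (generating_L1 lcG hw hL coneA).
- exact: (proper_L1 hw hL clA).
- by move=> [_ latA]; exact: (banach_lattice_L1 lcG hw hL clA latA).
- move=> [_ latA] isoA; split; last exact: (banach_lattice_L1 lcG hw hL clA latA).
  split; [split| |].
  + exact: (beurling_bilinear hmulL).
  + exact: (mulL_assoc hsys hbdd hmu hL hmulL).
  + by apply: (mulL_norm hsys hbdd hmu hw hL hmulL) => s; have [] := isoA s.
  + exact: is_cone_L1.
  + exact: (L1_cone_mul hsys hbdd hmu hmulL).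
Qed.
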